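(* Let $p$ be a prime and let $\mathcal{F}=\mathbb{F}_q(x,y)$ be an extension of $\mathbb{F}_q(x)$ of degree $p$ given by $y^p=B(x)$, where $B(x)\in\mathbb{F}_q[x]$ is squarefree and factors into $r$ distinct irreducible polynomials. Assume that $p$ divides neither $\deg(B)$ nor the characteristic of $\mathbb{F}_q$, and that $r\ge 2$. Then $p$ divides the class number $h$ of $\mathcal{F}$.
   Context: $\mathbb{F}_q$ is the finite field with $q$ elements and $x$ is transcendental over it. The class number $h$ is the divisor class number, i.e. the order of the group of degree-$0$ divisors of $\mathcal{F}/\mathbb{F}_q$ modulo principal divisors. *)

(* Defs.v *)
From HB Require Import structures.
From mathcomp Require Import all_boot all_order all_algebra all_field.
From mathcomp Require Import boolp classical_sets cardinality.
From mathcomp Require Import freeg.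

Set Implicit Arguments.
Unset Strict Implicit.
Unset Printing Implicit Defensive.

Import Order.TTheory GRing.Theory Num.Theory.
Local Open Scope ring_scope.

(* Units of {poly K} are the polynomials of size 1. *)
Definition squarefree_poly (K : fieldType) (B : {poly K}) : Prop :=
  B != 0 /\ forall d : {poly K}, d ^+ 2 %| B -> size d = 1%N.

Definition factors_into (K : fieldType) (B : {poly K}) (r : nat) : Prop :=
  exists s : r.-tuple {poly K},
    [/\ uniq s,
        forall P, P \in s -> P \is monic /\ irreducible_poly P
      & B = lead_coef B *: \prod_(P <- s) P].

Section FunctionField.
Variables (Fq : finFieldType) (L : fieldExtType {fraction {poly Fq}}).

Definition const (c : Fq) : L := (tofrac c%:P)%:A.

Record is_place (v : L -> int) : Prop := IsPlace {
  place_val0 : v 0 = 0;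
  place_valM : forall z w, z != 0 -> w != 0 -> v (z * w) = v z + v w;
  place_valD : forall z w, z != 0 -> w != 0 -> z + w != 0 ->
    Num.min (v z) (v w) <= v (z + w);
  place_const : forall c : Fq, c != 0 -> v (const c) = 0;
  place_unif : exists t, v t = 1 }.

(* Places of L / Fq, given as normalized discrete valuations trivial on Fq.
   The value at 0 is +oo in the literature; here it is set to 0, so that a
   place is determined by its values at nonzero elements. *)
Record place := Place { val_at :> L -> int; placeP : is_place val_at }.

HB.instance Definition _ := gen_eqMixin place.
HB.instance Definition _ := gen_choiceMixin place.

(* Both sets contain 0, whatever the convention for [P 0]. *)
Definition valuation_ring (P : place) : set L := [set z | z = 0 \/ 0 <= P z].
Definition maximal_ideal (P : place) : set L := [set z | z = 0 \/ 0 < P z].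

Definition residue_basis (P : place) (d : nat) (b : 'I_d -> L) : Prop :=
  (forall i, valuation_ring P (b i)) /\
  forall z, valuation_ring P z ->
    exists! c : {ffun 'I_d -> Fq},
      maximal_ideal P (z - \sum_(i < d) const (c i) * b i).

(* The dimension over Fq of the residue field of P *)
Definition degree (P : place) : nat :=
  xget 0%N [set d | exists b : 'I_d -> L, residue_basis P b].

Definition divisor_degree (D : {freeg place}) : int :=
  fglift (fun P => (degree P)%:Z : int^o) D.

HB.instance Definition _ :=
  GRing.isZmodMorphism.Build {freeg place} int divisor_degree
    (@lift_is_additive int place int^o (fun P => (degree P)%:Z : int^o)).

Definition degree0 : {pred {freeg place}} := fun D => divisor_degree D == 0.

Fact degree0_zmod_closed : zmod_closed degree0.
Proof.
split=> [|D E]; rewrite !unfold_in.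
  by rewrite /degree0 raddf0.
rewrite /degree0 => /eqP dD /eqP dE.
by rewrite raddfB /= dD dE subrr.
Qed.

HB.instance Definition _ :=
  GRing.isZmodClosed.Build {freeg place} degree0 degree0_zmod_closed.

Record divisor0 := Divisor0 { div0_val :> {freeg place}; _ : div0_val \in degree0 }.

HB.instance Definition _ := [isSub for div0_val].
HB.instance Definition _ := [Choice of divisor0 by <:].
HB.instance Definition _ := [SubChoice_isSubZmodule of divisor0 by <:].

Definition principal : {pred divisor0} := fun D =>
  `[< exists2 z : L, z != 0 & forall P : place, coeff P (val D) = P z >].

Fact principal_zmod_closed : zmod_closed principal.
Proof.
have P1 (P : place) : P 1 = 0.
  have := place_valM (placeP P) (oner_neq0 L) (oner_neq0 L).
  by rewrite mulr1 => /eqP; rewrite -subr_eq0 opprD addNKr oppr_eq0 => /eqP.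
split=> [|D E].
  rewrite unfold_in; apply/asboolP; exists 1; first exact: oner_neq0.
  by move=> P; rewrite P1 coeff0.
rewrite !unfold_in => /asboolP[z z0 zD] /asboolP[w w0 wE].
apply/asboolP; exists (z / w) => [|P]; first by rewrite mulf_neq0 ?invr_eq0.
have zw0 : z / w != 0 by rewrite mulf_neq0 ?invr_eq0.
have := place_valM (placeP P) zw0 w0.
by rewrite divfK // coeffB zD wE => ->; rewrite addrK.
Qed.

HB.instance Definition _ :=
  GRing.isZmodClosed.Build divisor0 principal principal_zmod_closed.

Definition class_group : Type := Quotient.quot principal.

Definition is_class_number (h : nat) : Prop :=
  ([set: class_group] #= `I_h)%card.
End FunctionField.

(* Main.v *)
Require Import Defs.
From HB Require Import structures.
From mathcomp Require Import all_boot all_order all_algebra all_fingroup.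
From mathcomp Require Import all_solvable all_field.
From mathcomp Require Import boolp classical_sets cardinality.
From mathcomp Require Import ring zify.
From mathcomp Require Import freeg.

(** Write [k] for the finite field and [F = k(x, y)]. Let [Q1] and [Q2] be two
    of the irreducible factors of [B], and [m] the degree of [Q1]. The equation
    [y ^+ p = B] is of Eisenstein type at every prime factor of [B], and also
    at infinity, because [p] does not divide [deg B]. So there is a single
    place [P1] over [Q1], of degree [m], and a single place [Pinf] at infinity,
    of degree 1, both totally ramified. Hence [D = P1 - m Pinf] has degree 0
    and [p D] is the divisor of [Q1] ([torsion_principal]). It remains to see
    that [D] is not principal: its class then has order [p], translation by it
    permutes the [h] divisor classes without fixed points, and [p] divides [h]
    ([dvdn_card_translation]).

    Suppose [D] is the divisor of [z]. All poles of [z] lie at infinity, so [z]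
    is integral over [k[x]]; since [B] is squarefree and [p] is invertible,
    [z = \sum_(i < p) a_i * y ^+ i] with [a_i] in [k[x]]
    ([regular_integral]). At [P1] the function [z] vanishes, so [Q1] divides
    [a_0]. At the place over [Q2] it does not vanish, so [a_0] is not 0. At
    infinity the terms [a_i * y ^+ i] have values [- (p * deg a_i + i * deg B)],
    which are distinct modulo [p], so no cancellation occurs and the pole of
    [z] has order at least [p * deg a_0 >= p * m]. But this order is [m]
    ([torsion_nonprincipal]).

    That regular functions are integral requires enough places. A place is
    obtained from an order with field of fractions [F] and a prime ideal of it
    that is locally generated by one element ([place_of_datum]). This is
    applied to [k[X][y]] with [X = x] or [X = 1/x]: to the ideal [(Q, y)] if
    [Q] divides the right-hand side of the equation ([ramified_place_ex]), and
    to the ideal of a point above [Q], locally generated by [Q], if it does not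
    ([unramified_place_ex]). *)

Set Implicit Arguments.
Unset Strict Implicit.
Unset Printing Implicit Defensive.

Import Order.TTheory GRing.Theory Num.Theory.
Local Open Scope ring_scope.

(** * Values at a place *)

(** The value of 0 counts as infinite here, so that these conditions are stable
    under addition. *)
HB.lock Definition vge (Fq : finFieldType) (L : fieldExtType {fraction {poly Fq}})
    (P : place L) (n : int) (z : L) : bool :=
  (z == 0) || (n <= P z).

Section PlaceTheory.
Variables (Fq : finFieldType) (L : fieldExtType {fraction {poly Fq}}).
Implicit Types (P : place L) (z w : L).

Lemma val1 P : P 1 = 0.
Proof.
have := place_valM (placeP P) (oner_neq0 L) (oner_neq0 L).
by rewrite mulr1 => /eqP; rewrite -subr_eq0 opprD addNKr oppr_eq0 => /eqP.
Qed.

Lemma valM P z w : z != 0 -> w != 0 -> P (z * w) = P z + P w.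
Proof. exact: (place_valM (placeP P)). Qed.

Lemma valX P z n : z != 0 -> P (z ^+ n) = P z *+ n.
Proof.
move=> z0; elim: n => [|n IH]; first by rewrite expr0 val1.
by rewrite exprS valM ?expf_neq0 // IH mulrS.
Qed.

Lemma valV P z : z != 0 -> P z^-1 = - P z.
Proof.
move=> z0; apply/eqP; rewrite -addr_eq0 -valM ?invr_eq0 //.
by rewrite mulVf // val1.
Qed.

Lemma val_div P z w : z != 0 -> w != 0 -> P (z / w) = P z - P w.
Proof. by move=> z0 w0; rewrite valM ?invr_eq0 // valV. Qed.

Lemma valN P z : P (- z) = P z.
Proof.
have [->|z0] := eqVneq z 0; first by rewrite oppr0.
have N0 : (-1 : L) != 0 by rewrite oppr_eq0 oner_neq0.
suff PN1 : P (-1) = 0 by rewrite -mulN1r valM // PN1 add0r.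
have := valM P N0 N0; rewrite mulrNN mulr1 val1; lia.
Qed.

Lemma vgeE P n z : z != 0 -> vge P n z = (n <= P z).
Proof. by rewrite vge.unlock => /negPf->. Qed.

Lemma vge0 P n : vge P n 0.
Proof. by rewrite vge.unlock eqxx. Qed.

Lemma vge_le P m n z : n <= m -> vge P m z -> vge P n z.
Proof.
rewrite !vge.unlock => nm /orP[->//|mz].
by rewrite (le_trans nm mz) orbT.
Qed.

Lemma vgeD P n z w : vge P n z -> vge P n w -> vge P n (z + w).
Proof.
rewrite vge.unlock; have [->|z0] := eqVneq z 0; first by rewrite add0r.
have [->|w0] := eqVneq w 0; first by rewrite addr0 (negPf z0).
have [//|zw0] := eqVneq (z + w) 0 => /= nz nw.
by apply: le_trans (place_valD (placeP P) z0 w0 zw0); rewrite le_min nz nw.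
Qed.

Lemma vgeN P n z : vge P n (- z) = vge P n z.
Proof. by rewrite vge.unlock oppr_eq0 valN. Qed.

Lemma vgeM P m n z w : vge P m z -> vge P n w -> vge P (m + n) (z * w).
Proof.
have [->|z0] := eqVneq z 0; first by rewrite mul0r !vge0.
have [->|w0] := eqVneq w 0; first by rewrite mulr0 !vge0.
by rewrite !vgeE ?mulf_neq0 // valM //; exact: lerD.
Qed.

Lemma vgeMr P n z w : vge P n z -> vge P 0 w -> vge P n (z * w).
Proof. by move=> Pz Pw; rewrite -[n]addr0; apply: vgeM. Qed.

Lemma vgeX P z n : vge P 0 z -> vge P 0 (z ^+ n).
Proof.
move=> Pz; elim: n => [|n IH]; first by rewrite vge.unlock val1 orbT.
by rewrite exprS; apply: vgeMr.
Qed.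

Lemma vge_sum P n I (r : seq I) (A : pred I) (F : I -> L) :
  (forall i, A i -> vge P n (F i)) -> vge P n (\sum_(i <- r | A i) F i).
Proof. by move=> PF; elim/big_ind: _ => //; [exact: vge0|exact: vgeD]. Qed.

Lemma val_add_gt P z w : z != 0 -> vge P (P z + 1) w ->
  z + w != 0 /\ P (z + w) = P z.
Proof.
move=> z0 Pw; have [->|w0] := eqVneq w 0; first by rewrite addr0.
have lt_zw : P z + 1 <= P w by rewrite -vgeE.
have zw0 : z + w != 0.
  apply: contraTneq lt_zw => /eqP; rewrite addr_eq0 => /eqP->.
  by rewrite valN -ltNge ltrDl.
split=> //; apply/eqP; rewrite eq_le; apply/andP; split; last first.
  by rewrite -(vgeE _ _ zw0); apply: vgeD; rewrite vgeE //; lia.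
rewrite leNgt; apply/negP => lt_z.
have := vgeD (n := P z + 1) (P := P) (z := z + w) (w := - w).
rewrite vgeN Pw addrK !vgeE //; lia.
Qed.

(** The strict ultrametric inequality: among summands of distinct values the
    smallest value prevails, so that the sum has a value below all of them. *)
Lemma val_sum_distinct P (I : finType) (F : I -> L) (k : I) :
  (forall i j, i != j -> F i != 0 -> F j != 0 -> P (F i) != P (F j)) ->
  F k != 0 -> P (\sum_i F i) <= P (F k).
Proof.
move=> neqF Fk0.
have [i Fi0 min_i] := @Order.TotalTheory.arg_minP _ _ I k
  (fun i => F i != 0) (fun i => P (F i)) Fk0.
rewrite (bigD1 i) //=.
have [|_ ->] := @val_add_gt P (F i) (\sum_(j | j != i) F j) Fi0; last exact: min_i.
apply: vge_sum => j ji; have [->|Fj0] := eqVneq (F j) 0; first exact: vge0.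
rewrite vgeE // lezD1 lt_neqAle min_i // andbT.
by apply: neqF; rewrite // eq_sym.
Qed.

Lemma val_const P (c : Fq) : P (const L c) = 0.
Proof.
have [->|c0] := eqVneq c 0; last exact: (place_const (placeP P)).
by rewrite /const polyC0 rmorph0 scale0r (place_val0 (placeP P)).
Qed.

Lemma place_inj P1 P2 : val_at P1 =1 val_at P2 -> P1 = P2.
Proof.
case: P1 P2 => [v1 p1] [v2 p2] /= /funext e; case: _ / e in p2 *.
by congr Place; apply: Prop_irrelevance.
Qed.

Lemma valuation_ringE P z : valuation_ring P z <-> vge P 0 z.
Proof.
rewrite vge.unlock; split=> [[->|/= ->]|/orP[/eqP->|]]; rewrite ?eqxx ?orbT //.
  by left.
by right.
Qed.

Lemma maximal_idealE P z : maximal_ideal P z <-> vge P 1 z.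
Proof.
rewrite vge.unlock; split=> [[->|]|/orP[/eqP->|]]; first by rewrite eqxx.
- by rewrite /= => Pz; apply/orP; right; lia.
- by left.
- by move=> Pz; right; rewrite /=; lia.
Qed.

(** Two bases of the residue field have the same size, since the number of
    coordinate vectors is in both cases the number of residues. *)
Lemma residue_basis_leq P d1 d2 (b1 : 'I_d1 -> L) (b2 : 'I_d2 -> L) :
  residue_basis P b1 -> residue_basis P b2 -> (d1 <= d2)%N.
Proof.
move=> [b1int b1P] [b2int b2P].
have intS d (b : 'I_d -> L) (c : {ffun 'I_d -> Fq}) :
    (forall i, valuation_ring P (b i)) ->
    valuation_ring P (\sum_i const L (c i) * b i).
  move=> bint.
  apply/valuation_ringE/vge_sum => i _; apply: vgeMr.
    by rewrite vge.unlock val_const lexx orbT.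
  exact/valuation_ringE.
have /boolp.choice[g gP] : forall c : {ffun 'I_d1 -> Fq},
    exists c' : {ffun 'I_d2 -> Fq}, maximal_ideal P
      (\sum_i const L (c i) * b1 i - \sum_i const L (c' i) * b2 i).
  by move=> c; have [c' [c'P _]] := b2P _ (intS _ _ c b1int); exists c'.
suff /leq_card : injective g.
  by rewrite !card_ffun !card_ord leq_exp2l // card_finNzRing_gt1.
move=> c c' eqg; have [c0 [_ c0P]] := b1P _ (intS _ _ c b1int).
rewrite -(c0P c); last by apply/maximal_idealE; rewrite subrr vge0.
apply: c0P; apply/maximal_idealE.
have /maximal_idealE h1 := gP c; have /maximal_idealE h2 := gP c'.
rewrite eqg in h1; rewrite -vgeN in h2.
by have := vgeD h1 h2; rewrite opprB addrA subrK.
Qed.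

Lemma degree_basis P d (b : 'I_d -> L) : residue_basis P b -> degree P = d.
Proof.
move=> bP; apply: xget_unique => [|d' [b' b'P]]; first by exists b.
apply/eqP; rewrite eqn_leq.
by rewrite (residue_basis_leq bP b'P) (residue_basis_leq b'P bP).
Qed.

End PlaceTheory.

(** * The place of a locally principal prime *)

Section LocalDatum.
Variables (Fq : finFieldType) (L : fieldExtType {fraction {poly Fq}}).
Variables (R : comNzRingType) (phi : {rmorphism R -> L}).

(** [M] is the preimage in [R] of a prime ideal of the order [phi R]. As [s] is
    a unit at this prime, [datum_split] says that [t] generates it locally; with
    [datum_fin] in the place of a Noetherian hypothesis, the local ring is a
    discrete valuation ring with uniformizer [phi t]. *)
Record local_datum (M : pred R) (s t : R) : Prop := LocalDatum {
  datumB : forall a b, M a -> M b -> M (a - b);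
  datumM : forall a b, M (a * b) = M a || M b;
  datum1 : ~~ M 1;
  datum_ker : forall a, phi a = 0 -> M a;
  datum_t : M t;
  datum_t0 : phi t != 0;
  datum_s : ~~ M s;
  datum_split : forall a, M a -> exists b, phi (s * a) = phi (t * b);
  datum_frac : forall z, exists a b, phi b != 0 /\ z = phi a / phi b;
  datum_fin : forall a, phi a != 0 ->
    exists b u n, ~~ M u /\ phi (a * b) = phi (u * t ^+ n);
  datum_const : forall c, c != 0 -> exists2 e, ~~ M e & phi e = const L c }.

Variables (M : pred R) (s t : R).
Hypothesis datum : local_datum M s t.

Let M_unit a : ~~ M a -> phi a != 0.
Proof. by apply: contraNneq; exact: datum_ker datum a. Qed.

Let M_mul a b : ~~ M a -> ~~ M b -> ~~ M (a * b).
Proof. by rewrite (datumM datum) negb_or => -> ->. Qed.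

Let M_subK a b : M (a - b) -> M b -> M a.
Proof.
move=> Mab Mb; have M0 : M 0 by rewrite -(subrr b); apply: (datumB datum).
by have := datumB datum Mab (datumB datum M0 Mb); rewrite sub0r opprK subrK.
Qed.

(** Dividing by [t] as often as possible terminates: some multiple of [a] is
    [u * t ^+ n] with [u] outside [M], and then at most [n] divisions succeed. *)
Lemma datum_order a : phi a != 0 -> exists (n : nat) b c,
  [/\ ~~ M b, ~~ M c & phi (b * a) = phi (t ^+ n * c)].
Proof.
move=> a0; have [w [u [N [Mu eqN]]]] := datum_fin datum a0.
pose found k := exists n b c,
  [/\ (n < k)%N, ~~ M b, ~~ M c & phi (b * a) = phi (t ^+ n * c)].
have step k : found k \/
    exists b c, ~~ M b /\ phi (b * a) = phi (t ^+ k * c).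
  elim: k => [|k [IH|[b [c [Mb eqk]]]]].
  - by right; exists 1, a; rewrite (datum1 datum) // expr0.
  - by left; have [n [b [c [nk *]]]] := IH; exists n, b, c; split=> //; apply: ltnW.
  have [Mc|Mc] := boolP (M c); last by left; exists k, b, c.
  have [c' eqc] := datum_split datum Mc; right; exists (s * b), c'.
  rewrite M_mul ?(datum_s datum) //; split=> //.
  rewrite -mulrA rmorphM eqk -rmorphM mulrCA [LHS]rmorphM eqc -rmorphM mulrA.
  by rewrite -exprSr.
have [[n [b [c [_ *]]]]|[b [c [Mb eqS]]]] := step N.+1; first by exists n, b, c.
have t0 := datum_t0 datum.
(* N + 1 divisions of a, compared with a * w = u * t ^+ N, would put the
   product b * u of two elements outside M into M. *)
have : phi (b * u - t * (c * w)) = 0.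
  apply: (mulIf (expf_neq0 N t0)); rewrite mul0r -rmorphXn -rmorphM.
  have -> : (b * u - t * (c * w)) * t ^+ N =
            b * (u * t ^+ N) - t ^+ N.+1 * c * w by rewrite exprS; ring.
  by rewrite rmorphB rmorphM -eqN -rmorphM mulrA rmorphM eqS -rmorphM subrr.
move=> /(datum_ker datum) Md.
have Mt : M (t * (c * w)) by rewrite (datumM datum) (datum_t datum).
by have := M_subK Md Mt; rewrite (negPf (M_mul Mb Mu)).
Qed.

Let order z (n : int) := exists a b,
  [/\ ~~ M a, ~~ M b & z = phi t ^ n * (phi a / phi b)].

Let order_neq0 z n : order z n -> z != 0.
Proof.
move=> [a [b [Ma Mb ->]]].
by rewrite !mulf_neq0 ?invr_eq0 ?M_unit // expfz_neq0 // (datum_t0 datum).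
Qed.

Let order_unit a : ~~ M a -> order (phi a) 0.
Proof.
by move=> Ma; exists a, 1; rewrite (datum1 datum) // rmorph1 divr1 expr0z mul1r.
Qed.

Let orderM z w m n : order z m -> order w n -> order (z * w) (m + n).
Proof.
move=> [a [b [Ma Mb ->]]] [a' [b' [Ma' Mb' ->]]].
exists (a * a'), (b * b'); rewrite !M_mul //; split=> //.
rewrite expfzDr ?(datum_t0 datum) // !rmorphM invfM; ring.
Qed.

Let orderV z n : order z n -> order z^-1 (- n).
Proof.
move=> [a [b [Ma Mb ->]]]; exists b, a; split=> //.
by rewrite invfM invr_expz invf_div.
Qed.

Let order1 n : order 1 n -> n = 0.
Proof.
suff pos (k : nat) : ~ order 1 k.+1.
  case: n => [[|k]|k]; rewrite ?NegzE => // o1; first by case: (pos k).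
  by case: (pos k); have := orderV o1; rewrite invr1 opprK.
move=> [a [b [Ma Mb /(congr1 ( *%R^~ (phi b)))]]].
rewrite mul1r mulrA divfK ?M_unit // -exprnP => e.
have : phi (b - t ^+ k.+1 * a) = 0 by rewrite rmorphB e rmorphM rmorphXn subrr.
move=> /(datum_ker datum) Md.
have Mt : M (t ^+ k.+1 * a) by rewrite exprS -mulrA (datumM datum) (datum_t datum).
by have := M_subK Md Mt; rewrite (negPf Mb).
Qed.

Let order_inj z m n : order z m -> order z n -> m = n.
Proof.
move=> om on; apply/eqP; rewrite -subr_eq0; apply/eqP/order1.
by rewrite -[1](mulfV (order_neq0 om)); apply: orderM => //; apply: orderV.
Qed.

Let order_int a : phi a != 0 -> exists n : nat, order (phi a) n.
Proof.
move=> /datum_order[n [b [c [Mb Mc e]]]]; exists n, c, b; split=> //.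
apply: (mulfI (M_unit Mb)); rewrite -rmorphM e rmorphM rmorphXn -exprnP.
by have b0 := M_unit Mb; field.
Qed.

Let order_ex z : z != 0 -> exists n, order z n.
Proof.
have [a [b [b0 ->]]] := datum_frac datum z => ab0.
have a0 : phi a != 0 by apply: contraNneq ab0 => ->; rewrite mul0r.
have [[m oa] [n ob]] := (order_int a0, order_int b0).
by exists (m%:Z - n%:Z); apply: orderM => //; apply: orderV.
Qed.

Let v z : int := if z == 0 then 0 else xget 0 (order z).

Let vE z n : order z n -> v z = n.
Proof.
move=> on; rewrite /v (negPf (order_neq0 on)).
by apply: xget_unique => // m om; apply: order_inj om on.
Qed.

Let vP z : z != 0 -> order z (v z).
Proof. by move=> /order_ex[n on]; rewrite (vE on). Qed.

Let v_place : is_place v.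
Proof.
have leD z w : z != 0 -> w != 0 -> z + w != 0 -> v z <= v w -> v z <= v (z + w).
  move=> z0 w0 zw0 le_zw.
  have [a [b [Ma Mb ez]]] := vP z0; have [a' [b' [Ma' Mb' ew]]] := vP w0.
  have [k ek] : exists k : nat, v w = v z + k%:Z by exists `|v w - v z|%N; lia.
  (* Once the smaller power of t is factored out, the numerator c of the sum
     lies in the image of R, so its order is non-negative. *)
  pose c := a * b' + t ^+ k * a' * b.
  have eD : z + w = phi t ^ v z * (phi 1 / phi (b * b')) * phi c.
    have [b0 b'0] := (M_unit Mb, M_unit Mb').
    have alg (T Tk A B A' B' : L) : B != 0 -> B' != 0 ->
        T * (A / B) + T * Tk * (A' / B') =
        T * (1 / (B * B')) * (A * B' + Tk * A' * B).
      by move=> B0 B'0; field; rewrite ?B0 ?B'0.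
    rewrite [in LHS]ez [in LHS]ew ek expfzDr ?(datum_t0 datum) // -exprnP alg //.
    by rewrite /c rmorphD !rmorphM rmorphXn rmorph1.
  have c0 : phi c != 0 by apply: contraNneq zw0; rewrite eD => ->; rewrite mulr0.
  have [n on] := order_int c0.
  suff -> : v (z + w) = v z + n by rewrite lerDl.
  apply: vE; rewrite eD; apply: orderM on.
  by exists 1, (b * b'); rewrite (datum1 datum) // M_mul.
split.
- by rewrite /v eqxx.
- by move=> z w z0 w0; apply: vE; apply: orderM; apply: vP.
- move=> z w z0 w0 zw0; rewrite ge_min.
  case: (leP (v z) (v w)) => [|/ltW] le_zw; first by rewrite leD.
  by rewrite addrC leD ?orbT // addrC.
- move=> c c0; have [e Me <-] := datum_const datum c0.
  by apply: vE; apply: order_unit.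
- exists (phi t); apply: vE; exists 1, 1; rewrite (datum1 datum) //.
  by rewrite rmorph1 divr1 mulr1 expr1z.
Qed.

(** The order with respect to [t] is a place. The truth value [M a] is read as
    the integer 0 or 1 in the bound on [phi a]. Uniqueness: every element is a
    power of [phi t] times a unit, so a place for which these units have value
    0 is a multiple of the order, and both are normalized. *)
Lemma place_of_datum : exists P : place L,
  [/\ forall a, ~~ M a -> P (phi a) = 0, P (phi t) = 1,
      forall a, vge P (M a) (phi a),
      forall z, vge P 0 z -> exists a b, ~~ M b /\ z = phi a / phi b
    & forall P' : place L, (forall a, ~~ M a -> P' (phi a) = 0) ->
        0 < P' (phi t) -> P' = P].
Proof.
have unitE a : ~~ M a -> v (phi a) = 0 by move=> Ma; apply: vE; apply: order_unit.
exists (Place v_place); split=> //=.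
- by apply: vE; exists 1, 1; rewrite (datum1 datum) // rmorph1 divr1 mulr1 expr1z.
- move=> a; rewrite vge.unlock /=; have [//|a0] := eqVneq (phi a) 0.
  have [n on] := order_int a0; rewrite (vE on).
  case: n on => [|n] on; last by case: (M a).
  have [Ma|//] := boolP (M a); have [b eab] := datum_split datum Ma.
  have b0 : phi b != 0.
    apply: contraNneq a0 => b0; have := M_unit (datum_s datum); move: eab.
    by rewrite !rmorphM b0 mulr0 => /eqP; rewrite mulf_eq0 => /orP[->|].
  have [m om] := order_int b0.
  have : order (phi (t * b)) (1 + m%:Z).
    rewrite rmorphM; apply: orderM => //; exists 1, 1.
    by rewrite (datum1 datum) // rmorph1 divr1 mulr1 expr1z.
  rewrite -eab rmorphM => /order_inj/(_ (orderM (order_unit (datum_s datum)) on)).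
  by lia.
- move=> z; rewrite vge.unlock => /orP[/eqP->|].
    exists 0, 1; rewrite (datum1 datum) // rmorph0 mul0r; by split.
  have [->|z0] := eqVneq z 0.
    by move=> _; exists 0, 1; rewrite (datum1 datum) // rmorph0 mul0r; split.
  rewrite /=; have [a [b [Ma Mb]]] := vP z0; case: (v z) => // n -> _.
  by exists (t ^+ n * a), b; rewrite rmorphM rmorphXn mulrA.
move=> P' P'unit P't.
have P'E z n : order z n -> P' z = n * P' (phi t).
  move=> [a [b [Ma Mb ->]]]; have t0 := datum_t0 datum.
  rewrite valM ?mulf_neq0 ?invr_eq0 ?M_unit ?expfz_neq0 //.
  rewrite val_div ?M_unit // (P'unit a) // (P'unit b) // subrr addr0.
  case: n => n; first by rewrite -exprnP valX // pmulrn mulrzz mulrC.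
  rewrite NegzE -invr_expz valV ?expfz_neq0 // -exprnP valX //.
  by rewrite pmulrn mulrzz mulrC mulNr.
have t1 : P' (phi t) = 1.
  have [z z1] := place_unif (placeP P').
  have z0 : z != 0 by apply: contra_eq_neq z1 => ->; rewrite (place_val0 (placeP P')).
  have := P'E _ _ (vP z0); rewrite z1; move: (v z) (P' (phi t)) P't => k w w0 e.
  have k0 : 0 < k by nia.
  by nia.
apply: place_inj => z /=; have [->|z0] := eqVneq z 0.
  by rewrite (place_val0 (placeP P')) /v eqxx.
by rewrite (P'E _ _ (vP z0)) t1 mulr1.
Qed.

End LocalDatum.

(** * Presentations of the function field *)

Definition fconst (Fq : finFieldType) : Fq -> {fraction {poly Fq}} :=
  @tofrac {poly Fq} \o polyC.
HB.instance Definition _ Fq := GRing.RMorphism.on (@fconst Fq).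

HB.lock Definition atK (Fq : finFieldType) (X : {fraction {poly Fq}}) :
    {poly Fq} -> {fraction {poly Fq}} :=
  horner_eval X \o map_poly (@fconst Fq).

Section EvalK.
Variables (Fq : finFieldType) (X : {fraction {poly Fq}}).

Fact atK_is_zmod_morphism : zmod_morphism (atK X).
Proof. by rewrite atK.unlock; apply: rmorphB. Qed.

Fact atK_is_monoid_morphism : monoid_morphism (atK X).
Proof. by rewrite atK.unlock; split; [apply: rmorph1|apply: rmorphM]. Qed.

HB.instance Definition _ := GRing.isZmodMorphism.Build _ _ (atK X)
  atK_is_zmod_morphism.
HB.instance Definition _ := GRing.isMonoidMorphism.Build _ _ (atK X)
  atK_is_monoid_morphism.

End EvalK.

HB.lock Definition atL (Fq : finFieldType)
    (L : fieldExtType {fraction {poly Fq}}) (X : {fraction {poly Fq}}) (y : L) :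
    {poly {poly Fq}} -> L :=
  horner_eval y \o map_poly (in_alg L \o atK X).

Section EvalL.
Variables (Fq : finFieldType) (L : fieldExtType {fraction {poly Fq}}).
Variables (X : {fraction {poly Fq}}) (y : L).

Fact atL_is_zmod_morphism : zmod_morphism (atL X y).
Proof. by rewrite atL.unlock; apply: rmorphB. Qed.

Fact atL_is_monoid_morphism : monoid_morphism (atL X y).
Proof. by rewrite atL.unlock; split; [apply: rmorph1|apply: rmorphM]. Qed.

HB.instance Definition _ := GRing.isZmodMorphism.Build _ _ (atL X y)
  atL_is_zmod_morphism.
HB.instance Definition _ := GRing.isMonoidMorphism.Build _ _ (atL X y)
  atL_is_monoid_morphism.

End EvalL.

Section Presentation.
Variables (Fq : finFieldType) (L : fieldExtType {fraction {poly Fq}}).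
Local Notation K := {fraction {poly Fq}}.

Lemma atKC (X : K) c : atK X c%:P = tofrac c%:P.
Proof. by rewrite atK.unlock /= map_polyC /horner_eval hornerC. Qed.

Lemma atKX (X : K) : atK X 'X = X.
Proof. by rewrite atK.unlock /= map_polyX /horner_eval hornerX. Qed.

Lemma atLC X (y : L) c : atL X y c%:P = (atK X c)%:A.
Proof. by rewrite atL.unlock /= map_polyC /horner_eval hornerC. Qed.

Lemma atLX X (y : L) : atL X y 'X = y.
Proof. by rewrite atL.unlock /= map_polyX /horner_eval hornerX. Qed.

Lemma atL_const X (y : L) c : atL X y c%:P%:P = const L c.
Proof. by rewrite atLC atKC. Qed.

Lemma atLB X (y : L) (a b : {poly {poly Fq}}) :
  atL X y (a - b) = atL X y a - atL X y b.
Proof. exact: atL_is_zmod_morphism. Qed.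

Lemma atLM X (y : L) (a b : {poly {poly Fq}}) :
  atL X y (a * b) = atL X y a * atL X y b.
Proof. exact: (atL_is_monoid_morphism X y).2. Qed.

Lemma atL_sum X (y : L) (a : {poly {poly Fq}}) n : (size a <= n)%N ->
  atL X y a = \sum_(i < n) (atK X a`_i)%:A * y ^+ i.
Proof.
move=> an; rewrite atL.unlock /= /horner_eval (@horner_coef_wide _ n).
  by apply: eq_bigr => i _; rewrite coef_map.
by apply: leq_trans an; apply: size_poly.
Qed.

Lemma atK_tofrac (c : {poly Fq}) : atK (tofrac 'X) c = tofrac c.
Proof.
elim/poly_ind: c => [|c a IH]; first by rewrite !rmorph0.
by rewrite !rmorphD !rmorphM /= IH atKX atKC.
Qed.

(** A presentation of the function field as [k(X)(y)] with [y ^+ p = C(X)].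
    The field is used both with [X = x] and with [X = 1/x], so that the places
    at infinity need no separate treatment. *)
Record presentation (X : K) (y : L) (p : nat) (C : {poly Fq}) : Prop :=
  Presentation {
    pres_inj : forall c, atK X c = 0 -> c = 0;
    pres_frac : forall k, exists a b, b != 0 /\ k = atK X a / atK X b;
    pres_pow : y ^+ p = (atK X C)%:A;
    pres_gen : <<1; y>>%VS = fullv;
    pres_dim : \dim {:L} = p;
    pres_gt0 : (0 < p)%N }.

Section Theory.
Variables (X : K) (y : L) (p : nat) (C : {poly Fq}).
Hypothesis pres : presentation X y p C.

Let deg_y : adjoin_degree 1%AS y = p.
Proof.
have := dim_Fadjoin 1%AS y.
by rewrite dimv1 muln1 (pres_gen pres) (pres_dim pres) => <-.
Qed.

Lemma atK_neq0 c : c != 0 -> atK X c != 0.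
Proof. by apply: contraNneq => /(pres_inj pres)->. Qed.

Lemma atLC_neq0 c : c != 0 -> atL X y c%:P != 0.
Proof. by move=> c0; rewrite atLC scaler_eq0 oner_eq0 orbF atK_neq0. Qed.

Lemma atL_pow : y ^+ p = atL X y C%:P.
Proof. by rewrite atLC (pres_pow pres). Qed.

Lemma atL_free (a : {poly {poly Fq}}) : (size a <= p)%N -> atL X y a = 0 -> a = 0.
Proof.
move=> ap a0; have a0y := a0; rewrite atL.unlock in a0y.
have := @Fadjoin_poly_unique _ _ 1%AS y
  (map_poly (in_alg L \o atK X) a) 0.
rewrite linear0 deg_y => /(_ _ _ a0y) e.
have : map_poly (in_alg L \o atK X) a = 0.
  rewrite -e ?(leq_trans (size_poly _ _)) //.
  by apply/polyOverP => i; rewrite coef_map /= rpredZ ?rpred1.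
move=> /polyP eq0; apply/polyP => i; rewrite coef0; apply: (pres_inj pres).
have /eqP := eq0 i; rewrite coef_map !coef0 /= scaler_eq0 oner_eq0 orbF.
by move=> /eqP.
Qed.

Lemma common_denominator n (k : nat -> K) : exists b (a : nat -> {poly Fq}),
  b != 0 /\ forall i, (i < n)%N -> k i = atK X (a i) / atK X b.
Proof.
elim: n => [|n [b [a [b0 abP]]]]; first by exists 1, (fun=> 0); rewrite oner_eq0.
have [c [d [d0 kn]]] := pres_frac pres (k n).
exists (b * d), (fun i => if i == n then c * b else a i * d).
split=> [|i]; first by rewrite mulf_neq0.
have [aN0 dN0] := (atK_neq0 b0, atK_neq0 d0).
rewrite ltnS leq_eqVlt; case: eqP => [-> _|_ /= /abP->]; rewrite !rmorphM.
  by rewrite kn [LHS]mulrC -[LHS](mulfK aN0) invfM; ring.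
by rewrite -mulf_div divff ?mulr1.
Qed.

Lemma atL_frac z : exists (a : {poly {poly Fq}}) b,
  [/\ b != 0, (size a <= p)%N & z = atL X y a / atL X y b%:P].
Proof.
pose P := Fadjoin_poly 1%AS y z.
have zP : z = P.[y] by rewrite Fadjoin_poly_eq // (pres_gen pres) memvf.
have sP : (size P <= p)%N by rewrite -deg_y size_Fadjoin_poly.
have /boolp.choice[k kP] : forall i : nat, exists k : K, P`_i = k%:A.
  move=> i; have /polyOverP/(_ i)/vlineP[k ->] := Fadjoin_polyOver 1%AS y z.
  by exists k.
have [b [a [b0 abP]]] := common_denominator p k.
exists (\poly_(i < p) a i), b; split=> //.
apply: (mulIf (atLC_neq0 b0)); rewrite divfK ?atLC_neq0 //.
rewrite (atL_sum _ _ (size_poly _ _)) zP (horner_coef_wide _ sP) mulr_suml.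
apply: eq_bigr => i _; rewrite coef_poly ltn_ord kP abP ?ltn_ord // atLC.
by rewrite mulrAC -scalerAl mul1r scalerA divfK ?atK_neq0.
Qed.

Lemma pres_monic : 'X^p - C%:P \is monic.
Proof. by apply: monicXnsubC; rewrite (pres_gt0 pres). Qed.

Lemma atL_mod a : exists (q r : {poly {poly Fq}}),
  [/\ a = q * ('X^p - C%:P) + r, (size r <= p)%N & atL X y a = atL X y r].
Proof.
pose d := 'X^p - C%:P; pose q := Pdiv.CommonRing.rdivp a d.
pose r := Pdiv.CommonRing.rmodp a d.
have e : a = q * d + r by apply: (Pdiv.RingMonic.rdivp_eq pres_monic).
exists q, r; split=> //.
  rewrite -ltnS -(@size_XnsubC _ p C) ?(pres_gt0 pres) //.
  by rewrite Pdiv.CommonRing.ltn_rmodpN0 // monic_neq0 // pres_monic.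
rewrite e rmorphD rmorphM rmorphB rmorphXn /= atLX atL_pow subrr.
by rewrite mulr0 add0r.
Qed.

Lemma atL_ker a : atL X y a = 0 -> exists q, a = q * ('X^p - C%:P).
Proof.
have [q [r [-> sr ->]]] := atL_mod a; move/(atL_free sr)->.
by exists q; rewrite addr0.
Qed.

End Theory.
End Presentation.

(** * Irreducible polynomials and places *)

Section Irreducible.
Variable F : fieldType.
Implicit Types (Q a b : {poly F}).

Lemma irreducible_dvdM Q a b :
  irreducible_poly Q -> (Q %| a * b) = (Q %| a) || (Q %| b).
Proof.
move=> irrQ; apply/idP/orP => [|[]]; [|exact: dvdp_mulr|exact: dvdp_mull].
have [|nQa] := boolP (Q %| a); first by left.
by rewrite Gauss_dvdpr; [right|rewrite irreducible_poly_coprime].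
Qed.

Lemma irreducible_dvdC Q c : irreducible_poly Q -> c != 0 -> ~~ (Q %| c%:P).
Proof.
move=> [Q1 _] c0; apply/negP => /dvdp_leq; rewrite polyC_eq0 size_polyC c0.
by move=> /(_ isT); rewrite leqNgt Q1.
Qed.

Lemma irreducible_divisor b : b != 0 -> size b != 1%N ->
  exists2 Q, irreducible_poly Q & Q %| b.
Proof.
have [n] := ubnP (size b); elim: n b => // n IH b sb b0 b1.
have [irrb|nirr] := EM (irreducible_poly b); first by exists b.
apply: contrapT => noQ; apply: nirr; split=> [|q q1 qb].
  by rewrite ltn_neqAle eq_sym b1 size_poly_gt0.
rewrite -dvdp_size_eqp // eqn_leq dvdp_leq // leqNgt; apply/negP => ltq.
have q0 : q != 0 by apply: contraTneq qb => ->; rewrite dvd0p.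
have [Q irrQ Qq] := IH q (leq_trans ltq sb) q0 q1.
by apply: noQ; exists Q => //; apply: dvdp_trans Qq qb.
Qed.

Lemma irreducible_order Q b : irreducible_poly Q -> b != 0 ->
  exists k b', ~~ (Q %| b') /\ b = Q ^+ k * b'.
Proof.
move=> irrQ; have [n] := ubnP (size b); elim: n b => // n IH b sb b0.
have [/dvdpP[c bE]|nQb] := boolP (Q %| b); last first.
  by exists 0%N, b; rewrite expr0 mul1r.
move: b0; rewrite bE mulf_eq0 negb_or => /andP[c0 Q0].
have [|k [b' [nQb' cE]]] := IH c _ c0.
  move: sb; rewrite bE size_mul // => sb; have := irrQ.1.
  by move: (size Q) (size c) sb => *; lia.
by exists k.+1, b'; split=> //; rewrite cE exprSr mulrAC.
Qed.

End Irreducible.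

Section PlacePolynomials.
Variables (Fq : finFieldType) (L : fieldExtType {fraction {poly Fq}}).
Variables (X : {fraction {poly Fq}}) (y : L) (P : place L).
Hypothesis X_int : vge P 0 X%:A.

Lemma vge_atLC c : vge P 0 (atL X y c%:P).
Proof.
elim/poly_ind: c => [|c a IH]; first by rewrite rmorph0 vge0.
rewrite polyCD polyCM rmorphD rmorphM /=; apply: vgeD.
  by apply: vgeMr => //; rewrite atLC atKX.
by rewrite atL_const vge.unlock val_const lexx orbT.
Qed.

Lemma vge_atL a : vge P 0 y -> vge P 0 (atL X y a).
Proof.
move=> y_int; rewrite (atL_sum _ _ (leqnn _)); apply: vge_sum => i _.
by apply: vgeMr; [rewrite -(atLC X y) vge_atLC|apply: vgeX].
Qed.

(** By Bezout a polynomial prime to [Q] is invertible modulo [Q], hence a unit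
    at every place where [Q] vanishes. *)
Lemma val_coprime Q c : irreducible_poly Q -> 0 < P (atL X y Q%:P) ->
  ~~ (Q %| c) -> P (atL X y c%:P) = 0.
Proof.
move=> irrQ PQ; rewrite -irreducible_poly_coprime // => /Bezout_eq1_coprimepP.
move=> [[u w] /= uw].
have Q1 : vge P 1 (atL X y Q%:P) by apply/maximal_idealE; right.
have [c0|c0] := eqVneq (atL X y c%:P) 0; first by rewrite c0 (place_val0 (placeP P)).
have Pc : 0 <= P (atL X y c%:P) by rewrite -vgeE // vge_atLC.
apply/eqP; rewrite eq_le Pc andbT leNgt; apply/negP => Pc1.
have c1 : vge P 1 (atL X y c%:P) by apply/maximal_idealE; right.
have : vge P 1 (atL X y 1%:P).
  rewrite -uw polyCD !polyCM rmorphD !rmorphM /=.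
  by apply: vgeD; rewrite mulrC; apply: vgeMr; rewrite ?vge_atLC.
by rewrite rmorph1 vgeE ?oner_neq0 // val1.
Qed.

End PlacePolynomials.

(** * Totally ramified places *)

Section RamifiedPlace.
Variables (Fq : finFieldType) (L : fieldExtType {fraction {poly Fq}}).
Variables (X : {fraction {poly Fq}}) (y : L) (p : nat) (C : {poly Fq}).
Hypothesis pres : presentation X y p C.
Local Notation atL := (atL X y).

(** The inverse of [a] has a denominator in [k[X]]; this multiple of [a] stands
    in for its norm. *)
Lemma atL_multiple a : atL a != 0 ->
  exists w b, b != 0 /\ atL (a * w) = atL b%:P.
Proof.
move=> a0; have [w [b [b0 _ wE]]] := atL_frac pres (atL a)^-1.
exists w, b; split=> //.
by rewrite rmorphM /= -[atL w](divfK (atLC_neq0 pres b0)) -wE mulVKf.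
Qed.

Lemma poly_divX (R : nzRingType) (a : {poly R}) :
  exists a', a = a' * 'X + (a`_0)%:P.
Proof.
elim/poly_ind: a => [|a c _]; first by exists 0; rewrite mul0r coef0 add0r.
by exists a; rewrite coefD coefMX coefC add0r.
Qed.

Variables (Q C1 : {poly Fq}).
Hypotheses (irrQ : irreducible_poly Q) (CE : C = Q * C1) (nQC1 : ~~ (Q %| C1)).

(** Eisenstein at [Q]: the ideal [(Q, y)] is locally generated by [y], since
    [Q * C1 = y ^+ p] and [C1] is a unit there. *)
Lemma ramified_datum :
  local_datum (R := {poly {poly Fq}}) atL (fun a => Q %| a`_0) C1%:P 'X.
Proof.
have p0 := pres_gt0 pres.
have powX : atL ('X ^+ p) = atL (Q%:P * C1%:P).
  by rewrite rmorphXn /= atLX (atL_pow pres) CE polyCM.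
split=> /=.
- by move=> a b; rewrite coefB; apply: dvdp_sub.
- by move=> a b; rewrite coef0M irreducible_dvdM.
- by rewrite coefC eqxx irreducible_dvdC ?oner_eq0.
- move=> a /(atL_ker pres)[q ->]; rewrite coef0M coefB coefXn coefC /=.
  by rewrite eq_sym (gtn_eqF p0) sub0r CE mulrN dvdpNr dvdp_mull // dvdp_mulr.
- by rewrite coefX dvdp0.
- have C10 : C1 != 0 by apply: contraNneq nQC1 => ->; apply: dvdp0.
  have : C != 0 by rewrite CE mulf_neq0 ?(irredp_neq0 irrQ).
  move=> /(atLC_neq0 pres); rewrite -(atL_pow pres) atLX.
  by apply: contraNneq => ->; rewrite expr0n gtn_eqF.
- by rewrite coefC.
- move=> a /dvdpP[c ac]; have [a' ->] := poly_divX a; rewrite ac.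
  exists ('X^(p.-1) * c%:P + C1%:P * a').
  have -> : C1%:P * (a' * 'X + (c * Q)%:P) =
            c%:P * (Q%:P * C1%:P) + C1%:P * a' * 'X.
    by rewrite polyCM; ring.
  have -> : 'X * ('X^(p.-1) * c%:P + C1%:P * a') =
            c%:P * 'X^p + C1%:P * a' * 'X.
    by rewrite -[in 'X^p](prednK p0) exprS; ring.
  by rewrite 2!rmorphD; congr (_ + _); rewrite [LHS]rmorphM [RHS]rmorphM /= powX.
- move=> z; have [a [b [b0 _ ->]]] := atL_frac pres z.
  by exists a, b%:P; rewrite (atLC_neq0 pres b0).
- move=> a /atL_multiple[w [b [b0 wE]]].
  have [k [b' [nQb' bE]]] := irreducible_order irrQ b0.
  exists (w * C1%:P ^+ k), b'%:P, (p * k)%N; rewrite coefC; split=> //.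
  rewrite mulrA [LHS]rmorphM /= wE exprM [RHS]rmorphM [in RHS]rmorphXn /= powX.
  rewrite -[in RHS]rmorphXn -[RHS]rmorphM -[LHS]rmorphM /= bE; congr (atL _).
  by rewrite polyCM polyC_exp exprMn mulrCA mulrA.
- move=> c c0; exists c%:P%:P; last exact: atL_const.
  by rewrite !coefC /= irreducible_dvdC.
Qed.

(** The Eisenstein place above [Q], with uniformizer [y]. Its uniqueness is
    among the places where [X] has no pole. *)
Record ramified_place (P : place L) : Prop := RamifiedPlace {
  ram_degree : degree P = (size Q).-1;
  ram_y : P y = 1;
  ram_Q : P (atL Q%:P) = p;
  ram_unit : forall c, ~~ (Q %| c) -> P (atL c%:P) = 0;
  ram_int : forall a, vge P 0 (atL a);
  ram_unique : forall P' : place L,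
    vge P' 0 X%:A -> 0 < P' (atL Q%:P) -> P' = P }.

(** As [y] has residue 0, the residue field is [k[X]/(Q)]. *)
Lemma ramified_residue_basis (P : place L) :
    (forall c, ~~ (Q %| c) -> P (atL c%:P) = 0) ->
    (forall a : {poly {poly Fq}}, ~~ (Q %| a`_0) -> P (atL a) = 0) ->
    (forall a : {poly {poly Fq}}, vge P (Q %| a`_0) (atL a)) ->
    (forall z, vge P 0 z -> exists a b : {poly {poly Fq}},
       ~~ (Q %| b`_0) /\ z = atL a / atL b) ->
  residue_basis P (fun i : 'I_(size Q).-1 => atL ('X^i)%:P).
Proof.
move=> Punit PunitM PM Pfrac; set n := (size Q).-1.
have Q0 := irredp_neq0 irrQ.
have nE : n.+1 = size Q by rewrite prednK // size_poly_gt0.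
pose e (c : {ffun 'I_n -> Fq}) := rVpoly (\row_i c i).
have eE (c : {ffun 'I_n -> Fq}) :
    \sum_(i < n) const L (c i) * atL ('X^i)%:P = atL (e c)%:P.
  rewrite /e /rVpoly poly_def !rmorph_sum; apply: eq_bigr => i _.
  by rewrite valK mxE -mul_polyC !rmorphM /= atL_const.
have se c : (size (e c) < size Q)%N by rewrite -nE ltnS /e /rVpoly size_poly.
split=> [i|z].
  by apply/valuation_ringE; apply: vge_le (PM _); case: (_ %| _).
move=> /valuation_ringE/Pfrac[a [b [nQb ->]]].
have /Bezout_eq1_coprimepP[[u w] /= uw] : coprimep Q b`_0.
  by rewrite irreducible_poly_coprime.
(* The inverse of b`_0 modulo Q is w. *)
pose r := (a`_0 * w) %% Q.
have sr : (size r <= n)%N by rewrite -ltnS nE ltn_modp.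
pose c0 : {ffun 'I_n -> Fq} := [ffun i => poly_rV r 0 i].
have c0E : e c0 = r.
  rewrite /e -[RHS](poly_rV_K sr); congr rVpoly.
  by apply/rowP => i; rewrite mxE ffunE.
have b0 : atL b != 0 by apply: contraNneq nQb => /(datum_ker ramified_datum).
have zr : maximal_ideal P (atL a / atL b - atL r%:P).
  apply/maximal_idealE.
  have -> : atL a / atL b - atL r%:P = atL (a - r%:P * b) / atL b.
    by rewrite atLB atLM mulrBl mulfK.
  apply: vgeMr; last by rewrite vgeE ?invr_eq0 // valV // PunitM ?oppr0.
  have := PM (a - r%:P * b); rewrite coefB coef0M coefC /=.
  suff -> : Q %| a`_0 - r * b`_0 by [].
  have rE : r = a`_0 * w - (a`_0 * w) %/ Q * Q.
    by rewrite [X in X - _](divp_eq _ Q) addrC addKr.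
  have -> : a`_0 - r * b`_0 = (a`_0 * u + (a`_0 * w) %/ Q * b`_0) * Q.
    by rewrite rE -[X in X - _]mulr1 -uw; ring.
  exact: dvdp_mull.
exists c0; split=> [|c]; rewrite eE ?c0E // => /maximal_idealE zc.
move/maximal_idealE: zr; rewrite -vgeN => zr.
have := vgeD zr zc; rewrite opprB addrA subrK.
rewrite -atLB -polyCB => re.
have Qre : Q %| r - e c.
  apply: contraT => nQ; have re0 : r - e c != 0.
    by apply: contraNneq nQ => ->; apply: dvdp0.
  by move: re; rewrite vgeE ?(atLC_neq0 pres) // Punit.
have : r - e c == 0.
  apply: contraTT Qre => re0; apply/negP => /(dvdp_leq re0).
  rewrite leqNgt (leq_ltn_trans (size_polyD _ _)) // size_polyN.
  by rewrite gtn_max se andbT -nE ltnS.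
rewrite subr_eq0 => /eqP rec.
by apply/ffunP => i; rewrite ffunE rec /e rVpolyK mxE.
Qed.

Lemma ramified_place_ex : exists P, ramified_place P.
Proof.
have [P [/= PM0 Py PM Pfrac Puniq]] := place_of_datum ramified_datum.
rewrite /= atLX in Py Puniq.
have Punit c : ~~ (Q %| c) -> P (atL c%:P) = 0.
  by move=> nQc; apply: PM0; rewrite coefC.
have y0 : y != 0 by apply: contra_eq_neq Py => ->; rewrite (place_val0 (placeP P)).
have nz c : c != 0 -> atL c%:P != 0 by apply: (atLC_neq0 pres).
have C10 : C1 != 0 by apply: contraNneq nQC1 => ->; apply: dvdp0.
have val_C (P' : place L) : P' y *+ p = P' (atL Q%:P) + P' (atL C1%:P).
  rewrite -valM ?nz ?(irredp_neq0 irrQ) // -atLM -polyCM -CE -(atL_pow pres).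
  by rewrite valX.
exists P; split=> //.
- exact: degree_basis (ramified_residue_basis Punit PM0 PM Pfrac).
- by have := val_C P; rewrite (Punit C1) // addr0 Py => <-; rewrite -natz.
- by move=> a; apply: vge_le (PM a); case: (_ %| _).
(* A place above Q satisfies p * P' y = P' Q > 0, hence is centered at (Q, y). *)
move=> P' XP' QP'; have unitP' := val_coprime XP' irrQ QP'.
have y1 : 0 < P' y.
  have := val_C P'; rewrite (unitP' C1) // addr0 => e.
  have := QP'; rewrite -e; have := pres_gt0 pres; case: (p) => // k _.
  by rewrite pmulrn_lgt0.
have yint : vge P' 1 y by apply/maximal_idealE; right.
apply: Puniq => // a nQa; have [a' aE] := poly_divX a.
have a00 : a`_0 != 0 by apply: contraNneq nQa => ->; apply: dvdp0.
have [] := @val_add_gt _ _ P' (atL (a`_0)%:P) (atL (a' * 'X)) (nz _ a00).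
  rewrite unitP' // add0r rmorphM /= atLX mulrC; apply: vgeMr => //.
  by apply: vge_atL => //; apply: vge_le yint.
by move=> _; rewrite -rmorphD addrC -aE => ->; apply: unitP'.
Qed.

End RamifiedPlace.

(** * Unramified places *)

Lemma poly_splits (F : finFieldType) (q : {poly F}) : q != 0 ->
  exists (E : finFieldType) (f : {rmorphism F -> E}) (s : seq E),
    map_poly f q %= \prod_(z <- s) ('X - z%:P).
Proof.
move=> /FinSplittingFieldFor[L [s qs _]].
exists (FinFieldExtType L), (in_alg L), s; exact: qs.
Qed.

Lemma poly_divC (F : fieldType) (Q : {poly F}) (a : {poly {poly F}}) :
  (forall i, Q %| a`_i) -> exists a' : {poly {poly F}},
    (size a' <= size a)%N /\ a = Q%:P * a'.
Proof.
move=> Qa; exists (\poly_(i < size a) (a`_i %/ Q)); split; first exact: size_poly.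
apply/polyP => i; rewrite coefCM coef_poly mulrC.
by case: ltnP => [_|/leq_sizeP->//]; rewrite ?divpK // mul0r.
Qed.

Section UnramifiedPlace.
Variables (Fq : finFieldType) (L : fieldExtType {fraction {poly Fq}}).
Variables (X : {fraction {poly Fq}}) (y : L) (p : nat) (C : {poly Fq}).
Hypothesis pres : presentation X y p C.
Local Notation atL := (atL X y).
Variable Q : {poly Fq}.
Hypotheses (irrQ : irreducible_poly Q) (nQC : ~~ (Q %| C)).

Section Point.
Variables (E : finFieldType) (f : {rmorphism Fq -> E}) (xi : E).
Hypothesis Qxi : root (map_poly f Q) xi.

Definition evx : {poly Fq} -> E := horner_eval xi \o map_poly f.
HB.instance Definition _ := GRing.RMorphism.on evx.

Definition evxy (eta : E) : {poly {poly Fq}} -> E :=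
  horner_eval eta \o map_poly evx.
HB.instance Definition _ eta := GRing.RMorphism.on (evxy eta).

Lemma evxyC eta c : evxy eta c%:P = evx c.
Proof. by rewrite /evxy /= map_polyC /horner_eval hornerC. Qed.

Lemma evxyX eta : evxy eta 'X = eta.
Proof. by rewrite /evxy /= map_polyX /horner_eval hornerX. Qed.

Lemma evx_eq0 c : (evx c == 0) = (Q %| c).
Proof.
have Q0 : evx Q = 0 by apply/eqP.
apply/idP/idP => [/eqP c0|/dvdpP[d ->]]; last by rewrite rmorphM /= Q0 mulr0.
apply: contraT; rewrite -irreducible_poly_coprime // => /Bezout_eq1_coprimepP.
move=> [[u w] /= /(congr1 evx)]; rewrite rmorphD !rmorphM /= Q0 c0 !mulr0 addr0.
by rewrite rmorph1 => /eqP; rewrite eq_sym oner_eq0.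
Qed.

Variables (S : seq E).
Hypotheses (S_split : 'X^p - (evx C)%:P = \prod_(z <- S) ('X - z%:P)).
Hypothesis (p_neq0 : p%:R != 0 :> Fq).

Lemma uniq_S : uniq S.
Proof.
rewrite -separable_prod_XsubC -S_split separable_poly.unlock.
have C0 : evx C != 0 by rewrite evx_eq0.
have p0 : (p%:R : E) != 0 by rewrite -(rmorph_nat f) fmorph_eq0.
(* With g = Y ^+ p - c the combination Y * g' - p * g is the constant p * c. *)
apply/Bezout_coprimepP; exists (- (p%:R)%:P, 'X) => /=.
rewrite derivB derivC subr0 derivXn.
have -> : - (p%:R)%:P * ('X^p - (evx C)%:P) + 'X * ('X^(p.-1) *+ p) =
          (p%:R * evx C)%:P.
  rewrite mulrnAr -exprS prednK ?(pres_gt0 pres) //.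
  rewrite -[X in _ + X]mulr_natl polyCM polyC_natr.
  by rewrite mulNr mulrBr opprB subrK.
by rewrite -size_poly_eq1 size_polyC mulf_neq0.
Qed.

Lemma size_S : size S = p.
Proof.
have := size_prod_XsubC S id; rewrite -S_split size_XnsubC ?(pres_gt0 pres) //.
by case.
Qed.

Lemma root_S z : z \in S -> evxy z ('X^p - C%:P) = 0.
Proof.
move=> zS; have : root ('X^p - (evx C)%:P) z by rewrite S_split root_prod_XsubC.
by rewrite rmorphB rmorphXn /= evxyX evxyC /root !hornerE => /eqP.
Qed.

(** A polynomial of degree less than [p] in [y] that vanishes at all [p] points
    above [xi] is 0 modulo [Q]. *)
Lemma evx_coef_eq0 (a : {poly {poly Fq}}) : (size a <= p)%N ->
  (forall z, z \in S -> evxy z a = 0) -> forall i, Q %| a`_i.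
Proof.
move=> sa aS i; rewrite -evx_eq0 -coef_map.
suff -> : map_poly evx a = 0 by rewrite coef0.
apply/eqP; apply: contraT => a0.
have rootS : all (root (map_poly evx a)) S by apply/allP => z /aS /eqP.
have := max_poly_roots a0 rootS uniq_S.
by rewrite size_S ltnNge (leq_trans (size_poly _ _)).
Qed.

(** Here [s] is a product of polynomials over [k] that vanish at the points
    [(xi, z)] not conjugate to [(xi, eta)] but not at [(xi, eta)] itself. At a
    conjugate point [m] vanishes already: every polynomial that vanishes there
    vanishes at [(xi, eta)], and for the converse, if [m] does not vanish there
    then some [m ^+ N - 1] does, the residues being roots of unity. *)
Lemma separating_multiple eta : exists s, evxy eta s != 0 /\
  forall m z, evxy eta m = 0 -> z \in S -> evxy z (s * m) = 0.
Proof.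
have /boolp.choice[s sP] : forall z, exists m, evxy eta m != 0 /\
    (evxy z m = 0 \/ forall m', evxy z m' = 0 -> evxy eta m' = 0).
  move=> z.
  have [[m [m1 m0]]|nm] := EM (exists m, evxy z m = 0 /\ evxy eta m != 0).
    by exists m; split=> //; left.
  exists 1; rewrite rmorph1 oner_eq0; split=> //; right=> m m0.
  by apply/eqP; apply: contrapT => /negP m1; apply: nm; exists m.
exists (\prod_(z <- S) s z); split.
  by rewrite rmorph_prod prodf_seq_neq0; apply/allP => z _; apply: (sP z).1.
move=> m z m0 zS; rewrite rmorphM rmorph_prod (big_rem z) //=.
have [_ [->|ker_sub]] := sP z; first by rewrite !mul0r.
suff -> : evxy z m = 0 by rewrite mulr0.
apply/eqP; apply: contraT => mz; pose N := #|E|.-1.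
have E1 : (1 < #|E|)%N by apply: card_finNzRing_gt1.
have N0 : (0 < N)%N by rewrite -ltnS prednK // ltnW.
have mN : evxy z m ^+ N = 1.
  by apply: (mulfI mz); rewrite -exprS prednK ?expf_card ?mulr1 // ltnW.
have := ker_sub (m ^+ N - 1); rewrite !rmorphB !rmorphXn !rmorph1 /= mN subrr m0.
by rewrite expr0n gtn_eqF // sub0r => /(_ erefl)/eqP; rewrite oppr_eq0 oner_eq0.
Qed.

(** If [m] vanishes at [(xi, eta)], then [s * m] vanishes at all points above
    [xi], so it is a multiple of [Q] in [k[X][y]]. *)
Lemma unramified_datum eta : eta \in S -> exists s,
  local_datum (R := {poly {poly Fq}}) atL (fun a => evxy eta a == 0) s Q%:P.
Proof.
move=> etaS; have [s [s0 sM]] := separating_multiple eta; exists s; split=> /=.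
- by move=> a b /eqP a0 /eqP b0; rewrite rmorphB /= a0 b0 subrr.
- by move=> a b; rewrite rmorphM mulf_eq0.
- by rewrite rmorph1 oner_eq0.
- move=> a /(atL_ker pres)[q ->].
  by rewrite rmorphM /= root_S // mulr0.
- by rewrite evxyC evx_eq0.
- exact/(atLC_neq0 pres)/irredp_neq0.
- exact: s0.
- move=> m /eqP m0; have [q [r [smE sr ->]]] := atL_mod pres (s * m).
  have [|r' [_ ->]] := @poly_divC _ Q r; last by exists r'.
  apply: evx_coef_eq0 => // z zS; have := sM m z m0 zS.
  by rewrite smE rmorphD rmorphM /= root_S // mulr0 add0r.
- move=> z; have [a [b [b0 _ ->]]] := atL_frac pres z.
  by exists a, b%:P; rewrite (atLC_neq0 pres b0).
- move=> a /(atL_multiple pres)[w [b [b0 wE]]].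
  have [k [b' [nQb' bE]]] := irreducible_order irrQ b0.
  exists w, b'%:P, k; rewrite evxyC evx_eq0; split=> //.
  by rewrite wE bE polyCM polyC_exp mulrC.
- move=> c c0; exists c%:P%:P; last exact: atL_const.
  by rewrite evxyC evx_eq0 irreducible_dvdC.
Qed.

End Point.

(** Modulo [Q] the polynomial [a] is not 0 and has degree less than [p] in [y],
    so there is a point above [Q] where it does not vanish; the place is the one
    centered at this point. *)
Lemma unramified_place_ex (a : {poly {poly Fq}}) i :
  p%:R != 0 :> Fq -> (size a <= p)%N -> ~~ (Q %| a`_i) ->
  exists P : place L, [/\ vge P 0 X%:A, 0 < P (atL Q%:P),
    atL a != 0 & P (atL a) = 0].
Proof.
move=> p0 sa nQa.
have [E1 [f1 [[|xi s1 Qs1]]]] := poly_splits (irredp_neq0 irrQ).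
  rewrite big_nil -size_poly_eq1 size_map_poly => /eqP Q1.
  by have := irrQ.1; rewrite Q1.
have Qxi1 : root (map_poly f1 Q) xi.
  by rewrite (eqp_root Qs1) root_prod_XsubC mem_head.
pose D := 'X^p - (evx f1 xi C)%:P.
have D_monic : D \is monic by apply: monicXnsubC; rewrite (pres_gt0 pres).
have [E [f2 [S DS]]] := poly_splits (monic_neq0 D_monic).
pose f : {rmorphism Fq -> E} := f2 \o f1.
have Qxi : root (map_poly f Q) (f2 xi) by rewrite map_poly_comp fmorph_root.
have evxE c : evx f (f2 xi) c = f2 (evx f1 xi c).
  by rewrite /evx /= /horner_eval map_poly_comp horner_map.
have S_split : 'X^p - (evx f (f2 xi) C)%:P = \prod_(z <- S) ('X - z%:P).
  have eD : map_poly f2 D = 'X^p - (evx f (f2 xi) C)%:P.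
    by rewrite rmorphB /= map_polyXn map_polyC evxE.
  apply/eqP; rewrite -eD -eqp_monic //; last exact: monic_prod_XsubC.
  by rewrite map_monic.
have [eta etaS nroot] : exists2 eta, eta \in S & evxy f (f2 xi) eta a != 0.
  apply: contrapT => noeta; move/negP: nQa; apply.
  apply: (evx_coef_eq0 Qxi S_split) => // z zS.
  by apply/eqP; apply: contrapT => /negP nz; apply: noeta; exists z.
have [s datum] := unramified_datum Qxi S_split p0 etaS.
have [P [Punit PQ Pint _ _]] := place_of_datum datum.
exists P; split; rewrite ?PQ ?Punit //.
- by rewrite -(atKX X) -(atLC X y); apply: vge_le (Pint _); case: (_ == 0).
- by apply: contraNneq nroot => /(datum_ker datum).
Qed.

End UnramifiedPlace.

(** * Integral functions *)

Section PowerBasis.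
Variables (Fq : finFieldType) (L : fieldExtType {fraction {poly Fq}}).
Variables (X : {fraction {poly Fq}}) (y : L) (p : nat) (C : {poly Fq}).
Hypothesis pres : presentation X y p C.
Local Notation atL := (atL X y).

(** Where the values of [k(X)] are multiples of [p] and the value of [y] is
    prime to [p], the terms of [\sum_i a_i * y ^+ i] have distinct values. *)
Lemma val_power_basis (P : place L) (a : {poly {poly Fq}}) i :
    prime p -> ~~ (p %| P y)%Z ->
    (forall c, c != 0 -> (p %| P (atL c%:P))%Z) ->
    (size a <= p)%N -> a`_i != 0 ->
  P (atL a) <= P (atL (a`_i)%:P) + P y * i.
Proof.
move=> p_pr Py PC sa ai0.
have y0 : y != 0.
  by apply: contraNneq Py => ->; rewrite (place_val0 (placeP P)) dvdz0.
have ip : (i < p)%N.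
  by apply: leq_trans sa; rewrite ltnNge; apply: contra ai0 => /leq_sizeP->.
pose F (j : 'I_p) := atL (a`_j)%:P * y ^+ j.
have FE (j : 'I_p) : F j != 0 ->
    a`_j != 0 /\ P (F j) = P (atL (a`_j)%:P) + P y * j.
  rewrite mulf_eq0 negb_or => /andP[aj0 yj0].
  by rewrite /F valM // valX // pmulrn mulrzz; split=> //;
     apply: contraNneq aj0 => ->; rewrite polyC0 rmorph0.
have Fi0 : F (Ordinal ip) != 0.
  by rewrite mulf_neq0 ?expf_neq0 ?(atLC_neq0 pres).
rewrite -(FE (Ordinal ip) Fi0).2 (atL_sum _ _ sa).
under eq_bigr do rewrite -(atLC X y); apply: val_sum_distinct => // j k jk.
move=> /FE[aj0 ->] /FE[ak0 ->]; apply: contra jk => /eqP e.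
have : (p %| P y * (j%:Z - k%:Z))%Z.
  have -> : P y * (j%:Z - k%:Z) = P (atL (a`_k)%:P) - P (atL (a`_j)%:P).
    by rewrite mulrBr; lia.
  by apply: rpredB; exact: PC.
rewrite Gauss_dvdzr; last by rewrite coprimezE prime_coprime.
rewrite dvdzE /= => /dvdn_leq lejk; apply/eqP/val_inj => /=.
by have := ltn_ord j; have := ltn_ord k; lia.
Qed.

Hypothesis p_prime : prime p.

Lemma ramified_power_basis Q P (a : {poly {poly Fq}}) i :
    irreducible_poly Q -> ramified_place X y p Q P ->
    (size a <= p)%N -> ~~ (Q %| a`_i) ->
  P (atL a) <= i.
Proof.
move=> irrQ ram sa nQa.
have ai0 : a`_i != 0 by apply: contraNneq nQa => ->; apply: dvdp0.
apply: le_trans (val_power_basis p_prime _ _ sa ai0) _.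
- by rewrite (ram_y ram) dvdzE /= dvdn1; case: (p) p_prime => [|[|]].
- move=> c c0; have [k [b [nQb ->]]] := irreducible_order irrQ c0.
  have Q0 := irredp_neq0 irrQ.
  have b0 : b != 0 by apply: contraNneq nQb => ->; apply: dvdp0.
  rewrite polyCM polyC_exp atLM valM ?(atLC_neq0 pres) ?expf_neq0 //; last first.
    by rewrite -polyC_exp (atLC_neq0 pres) ?expf_neq0.
  rewrite (ram_unit ram nQb) addr0 -polyC_exp.
  have -> : atL (Q ^+ k)%:P = atL Q%:P ^+ k by rewrite polyC_exp rmorphXn.
  by rewrite valX ?(atLC_neq0 pres) // (ram_Q ram) pmulrn mulrzz dvdz_mulr.
by rewrite (ram_unit ram nQa) (ram_y ram) add0r mul1r.
Qed.

Hypothesis C_sqfree : forall Q, irreducible_poly Q -> Q %| C ->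
  exists C1, C = Q * C1 /\ ~~ (Q %| C1).
Hypothesis p_neq0 : p%:R != 0 :> Fq.

(** In lowest terms [z] has no denominator. If a prime [Q] divided it, some
    coefficient of the numerator would be prime to [Q], and then there is a
    place above [Q] where the numerator has a value smaller than [Q], hence [z]
    a pole: this value is less than [p], the value of [Q], at the ramified place
    if [Q] divides [C], and it is 0 at a suitable unramified place otherwise. *)
Lemma regular_integral z : (forall P : place L, vge P 0 X%:A -> vge P 0 z) ->
  exists a : {poly {poly Fq}}, (size a <= p)%N /\ z = atL a.
Proof.
move=> zint; have [a [b [b0 sa zE]]] := atL_frac pres z.
have [n] := ubnP (size b); elim: n a b b0 sa zE => // n IH a b b0 sa zE sb.
have [b1|b1] := eqVneq (size b) 1%N.
  have [c c0 bE] : exists2 c, c != 0 & b = c%:P by apply/size_poly1P/eqP.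
  exists (c^-1%:P *: a); split; first exact: leq_trans (size_scale_leq _ _) sa.
  rewrite zE -mul_polyC atLM bE mulrC; congr (_ * _).
  apply: (mulfI (atLC_neq0 pres (_ : c%:P != 0))); first by rewrite polyC_eq0.
  rewrite mulfV ?(atLC_neq0 pres) ?polyC_eq0 //.
  by rewrite -atLM -!polyCM mulfV // rmorph1.
have [Q irrQ Qb] := irreducible_divisor b0 b1.
have [b' bE] : exists b', b = b' * Q by apply/dvdpP.
have [b'0 Q0] : b' != 0 /\ Q != 0.
  by move: b0; rewrite bE mulf_eq0 negb_or => /andP.
have bN0 := atLC_neq0 pres b0.
have Qa i : Q %| a`_i.
  apply: contraT => nQa.
  have aN0 : atL a != 0.
    apply: contraNneq nQa => /(atL_free pres sa)->; rewrite coef0; exact: dvdp0.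
  have valz (P : place L) : vge P 0 X%:A -> P (atL Q%:P) <= P (atL a).
    move=> PX; have := zint P PX; rewrite zE vgeE ?mulf_neq0 ?invr_eq0 //.
    rewrite val_div // bE polyCM atLM valM ?(atLC_neq0 pres) // subr_ge0.
    have := vge_atLC y PX b'; rewrite vgeE ?(atLC_neq0 pres) // => b'_ge0.
    by apply: le_trans; rewrite lerDr.
  have [QC|nQC] := boolP (Q %| C).
    have [C1 [CE nQC1]] := C_sqfree irrQ QC.
    have [P ram] := ramified_place_ex pres irrQ CE nQC1.
    have PX : vge P 0 X%:A by have := ram_int ram ('X%:P); rewrite atLC atKX.
    have le_p := valz P PX; rewrite (ram_Q ram) in le_p.
    have ip : (i < p)%N.
      apply: leq_trans sa; have [//|si] := ltnP i (size a).
      by move: nQa; rewrite nth_default // dvdp0.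
    have := le_trans le_p (ramified_power_basis irrQ ram sa nQa).
    by rewrite lez_nat leqNgt ip.
  have [P [PX PQ _ Pa]] := unramified_place_ex pres irrQ nQC p_neq0 sa nQa.
  by have := valz P PX; rewrite Pa leNgt PQ.
have [a' [sa' aE]] := poly_divC Qa.
apply: (IH a' b') => //; first exact: leq_trans sa' sa.
  rewrite zE aE bE polyCM !atLM [X in X / _]mulrC -mulf_div.
  by rewrite divff ?(atLC_neq0 pres) // mulr1.
move: sb; rewrite bE size_mul //; have := irrQ.1.
by move: (size Q) (size b') => *; lia.
Qed.

End PowerBasis.

(** * Translations of a finite abelian group *)

(** Translation by [g] generates a [p]-group of permutations that has no fixed
    point, so the number of points is 0 modulo [p]. *)
Lemma dvdn_card_translation (T : zmodType) (p h : nat) (e : 'I_h -> T) (g : T) :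
  prime p -> bijective e -> g != 0 -> g *+ p = 0 -> (p %| h)%N.
Proof.
move=> p_pr [F eK Fe] g0 gp.
have inj_t : injective (fun i => F (e i + g)).
  by move=> i j /(can_inj Fe)/addIr/(can_inj eK).
pose s := perm inj_t.
have sX n i : (s ^+ n)%g i = F (e i + g *+ n).
  elim: n => [|n IH]; first by rewrite expg0 perm1 mulr0n addr0 eK.
  by rewrite expgSr permM IH permE Fe mulrSr addrA.
have sp : (s ^+ p = 1)%g.
  by apply/permP => i; rewrite sX gp addr0 eK perm1.
have pG : (p.-group <[s]>)%g.
  by apply: pnat_dvd (pnat_id p_pr); rewrite order_dvdn sp.
have acts : [acts <[s]>, on [set: 'I_h] | 'P]%g.
  by apply/actsP => a _ i; rewrite !inE.
have := pgroup_fix_mod pG acts; rewrite cardsT card_ord.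
suff -> : 'Fix_([set: 'I_h] | 'P)(<[s]>)%g = finset.set0.
  by rewrite cards0 mod0n => /eqP.
apply/setP => i; rewrite finset.in_setI finset.in_set0.
apply/negbTE/negP => /andP[_ /afixP fix_i]; have := fix_i s (cycle_id s).
rewrite /= apermE permE => /(congr1 e); rewrite Fe => /eqP.
by rewrite -[X in _ == X]addr0 (inj_eq (addrI _)) (negPf g0).
Qed.

Lemma class_number_bijective (Fq : finFieldType)
    (L : fieldExtType {fraction {poly Fq}}) h :
  is_class_number L h -> exists e : 'I_h -> class_group L, bijective e.
Proof.
move=> /card_set_bijP[f [fh finj fsurj]].
have lt_f D : (f D < h)%N by exact: fh.
pose F D := Ordinal (lt_f D).
have injF : injective F by move=> D E /(congr1 val)/finj; apply; rewrite inE.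
have surjF i : exists D, F D = i.
  have [D _ fD] := fsurj i (ltn_ord i); exists D; exact: val_inj.
have [e Fe] := boolp.choice surjF.
exists e; exists F => [//|D]; by apply: injF; rewrite Fe.
Qed.

(** * Exchanging the variable with its inverse *)

Lemma fraction_quotient (R : idomainType) (k : {fraction R}) :
  exists n d, d != 0 /\ k = tofrac n / tofrac d.
Proof.
elim/quotW: k => r; exists (frac r).1, (frac r).2.
have d0 := denom_ratioP r; split=> //.
apply: (canRL (mulfK _)); first by rewrite tofrac_eq0.
unlock FracField.tofrac; rewrite -[LHS]FracField.pi_mul; apply/eqmodP.
rewrite /= /FracField.equivf /FracField.mulf !numden_Ratio ?mulf_neq0 ?oner_eq0 //.
by rewrite !mulr1 mulrC.
Qed.

Section Reciprocal.
Variable F : fieldType.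

Lemma expr_complement (X : F) n k : X != 0 -> (k <= n)%N ->
  X ^+ k = X ^+ n * X^-1 ^+ (n - k).
Proof.
move=> X0 kn; rewrite -{1}(subnK kn) exprD exprVn mulrAC divff ?mul1r //.
exact: expf_neq0.
Qed.

(** The polynomial [X ^+ deg c * c(1/X)]. *)
Definition reciprocal (c : {poly F}) : {poly F} := Poly (rev c).

Lemma reciprocal_coef0 (c : {poly F}) : (reciprocal c)`_0 = lead_coef c.
Proof.
rewrite coef_Poly; have [->|c0] := eqVneq c 0.
  by rewrite polyseq0 lead_coef0.
by rewrite nth_rev ?size_poly_gt0 // subn1.
Qed.

Lemma div_exchange (X a b : F) m n :
  X ^+ m * a / (X ^+ n * b) = X^-1 ^+ n * a / (X^-1 ^+ m * b).
Proof. by rewrite !exprVn !invfM invrK; ring. Qed.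

Lemma coef_reciprocal (c : {poly F}) i : (i < size c)%N ->
  (reciprocal c)`_i = c`_((size c).-1 - i).
Proof. by move=> ic; rewrite coef_Poly nth_rev // subnS -predn_sub. Qed.

Lemma size_reciprocal (c : {poly F}) : (size (reciprocal c) <= size c)%N.
Proof. by apply: leq_trans (size_Poly _) _; rewrite size_rev. Qed.

Lemma dvdX_reciprocal c : c != 0 -> ~~ ('X %| reciprocal c).
Proof.
move=> c0; rewrite -['X]subr0 dvdp_XsubCl /root horner_coef0 reciprocal_coef0.
by rewrite lead_coef_eq0.
Qed.

Lemma irreducible_X : irreducible_poly ('X : {poly F}).
Proof. by rewrite -['X]subr0; apply: irredp_XsubC. Qed.

End Reciprocal.

Lemma expr_uniformizer (R : comNzRingType) (y v w r : R) p d i j :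
    y ^+ p = v ^+ d * r -> v * w = 1 -> (j * d + 1 = i * p)%N ->
  (y ^+ j * w ^+ i) ^+ p = w * r ^+ j.
Proof.
move=> yp vw ij; rewrite exprMn -!exprM mulnC exprM yp -ij addn1 exprS.
rewrite exprMn -exprM [(d * j)%N]mulnC mulrCA; congr (_ * _).
by rewrite mulrAC -exprMn vw expr1n mul1r.
Qed.

(** The exponent [p.-1 * d] is an inverse of [j] modulo [p], because
    [j * (p.-1 * d) = p.-1 * (i * p - 1)]. *)
Lemma expr_recover (R : comNzRingType) (y w : R) p d i j :
    (1 < p)%N -> (j * d + 1 = i * p)%N -> exists m n,
  (y ^+ j * w ^+ i) ^+ (p.-1 * d) = y * ((y ^+ p) ^+ m * w ^+ n).
Proof.
move=> p1 ij; exists (p.-1 * i).-1, (i * (p.-1 * d))%N.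
rewrite exprMn -!exprM mulrA -exprS; congr (y ^+ _ * _).
have i0 : (0 < i)%N by case: (i) ij => //; rewrite mul0n addn1.
have : (0 < p.-1 * i)%N by rewrite muln_gt0 i0 andbT -ltnS prednK // ltnW.
move=> /prednK; move: (_.-1) => m mE.
have -> : (j * (p.-1 * d) = p.-1 * (j * d))%N by rewrite mulnCA.
have pE : p = p.-1.+1 by rewrite prednK // ltnW.
move: (p.-1) pE mE => q pE mE; subst p; nia.
Qed.

Section Infinity.
Variables (Fq : finFieldType) (L : fieldExtType {fraction {poly Fq}}).
Local Notation K := {fraction {poly Fq}}.

Lemma atK_reciprocal (X : K) c : X != 0 -> c != 0 ->
  atK X c = X ^+ (size c).-1 * atK X^-1 (reciprocal c).
Proof.
move=> X0 c0; have sc : (size c).-1.+1 = size c by rewrite prednK ?size_poly_gt0.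
have sumE (Y : K) (a : {poly Fq}) n : (size a <= n)%N ->
    atK Y a = \sum_(i < n) fconst a`_i * Y ^+ i.
  move=> an; rewrite atK.unlock /= /horner_eval (@horner_coef_wide _ n).
    by apply: eq_bigr => i _; rewrite coef_map.
  by apply: leq_trans an; apply: size_poly.
rewrite (sumE _ _ _ (leqnn _)) (sumE _ _ _ (size_reciprocal c)) -sc mulr_sumr.
rewrite [RHS](reindex_inj rev_ord_inj) /=; apply: eq_bigr => i _.
have ile : (i <= (size c).-1)%N by rewrite -ltnS.
rewrite coef_reciprocal; last first.
  by rewrite subSS -[X in (_ < X)%N]sc ltnS leq_subr.
rewrite subSS subKn // mulrCA; congr (_ * _).
exact: expr_complement.
Qed.

Lemma presentation_finite (y : L) p (B : {poly Fq}) :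
    <<1; y>>%VS = fullv -> \dim {:L} = p -> (0 < p)%N ->
    y ^+ p = (tofrac B)%:A ->
  presentation (tofrac 'X) y p B.
Proof.
move=> gen dim p0 yp; split=> //.
- by move=> c; rewrite atK_tofrac => /eqP; rewrite tofrac_eq0 => /eqP.
- move=> k; have [n [d [d0 ->]]] := fraction_quotient k.
  by exists n, d; rewrite !atK_tofrac.
by rewrite atK_tofrac.
Qed.

Section Inverse.
Variables (X : K) (y : L) (p : nat) (B : {poly Fq}).
Hypothesis pres : presentation X y p B.

Let X0 : X != 0.
Proof. by rewrite -(atKX X) (atK_neq0 pres) // polyX_eq0. Qed.

(** With [j * deg B + 1 = i * p], the element [y ^+ j / X ^+ i] has the simple
    zero [1/X] as a factor of its [p]-th power: the Eisenstein situation, now at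
    the prime [1/X] of [k[1/X]]. It generates the field because [j] is prime to
    [p], so that one of its powers is [y] up to a factor in [k(X)]. *)
Lemma presentation_inverse i j : prime p -> B != 0 ->
    (j * (size B).-1 + 1 = i * p)%N ->
  presentation X^-1 (y ^+ j * (X^-1)%:A ^+ i) p ('X * reciprocal B ^+ j).
Proof.
move=> p_pr B0 ij; have Xi0 : X^-1 != 0 by rewrite invr_eq0; exact: X0.
split; [| | | |exact: pres_dim pres|exact: pres_gt0 pres].
- move=> c cX; apply/eqP; apply: contraT => c0.
  have rec0 : reciprocal c = 0.
    apply: (pres_inj pres); have := cX; rewrite (atK_reciprocal Xi0 c0) invrK.
    by move/eqP; rewrite mulf_eq0 (negPf (expf_neq0 _ Xi0)) => /eqP.
  by have := dvdX_reciprocal c0; rewrite rec0 dvdp0.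
- move=> k; have [n [d [d0 ->]]] := pres_frac pres k.
  have [->|n0] := eqVneq n 0.
    by exists 0, 1; rewrite oner_eq0 !rmorph0 !mul0r.
  have rec0 (c : {poly Fq}) : c != 0 -> reciprocal c != 0.
    by move=> /dvdX_reciprocal; apply: contraNneq => ->; exact: dvdp0.
  exists ('X ^+ (size d).-1 * reciprocal n), ('X ^+ (size n).-1 * reciprocal d).
  split.
    by rewrite mulf_neq0 ?(rec0 _ d0) // expf_neq0 // polyX_eq0.
  rewrite (atK_reciprocal X0 d0) (atK_reciprocal X0 n0) !rmorphM !rmorphXn /= atKX.
  exact: div_exchange.
- have vE : y ^+ p = X%:A ^+ (size B).-1 * (atK X^-1 (reciprocal B))%:A.
    rewrite (pres_pow pres) (atK_reciprocal X0 B0) -!in_algE.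
    by rewrite rmorphM rmorphXn.
  have vw : X%:A * (X^-1)%:A = 1 :> L.
    by rewrite -!in_algE -rmorphM (mulfV X0) rmorph1.
  rewrite (expr_uniformizer vE vw ij) rmorphM rmorphXn /= atKX -!in_algE.
  by rewrite [RHS]rmorphM rmorphXn.
set w : L := (X^-1)%:A; set y' := y ^+ j * w ^+ i.
have w0 : w != 0 by rewrite scaler_eq0 oner_eq0 orbF.
have [m [n yE]] := expr_recover y w (prime_gt1 p_pr) ij.
have yp0 : y ^+ p != 0 by rewrite (atL_pow pres) (atLC_neq0 pres).
have c0 : (y ^+ p) ^+ m * w ^+ n != 0.
  by rewrite mulf_neq0 ?(expf_neq0 m yp0) ?(expf_neq0 n w0).
have cin : (y ^+ p) ^+ m * w ^+ n \in <<1; y'>>%VS.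
  have Ain (k : K) : k%:A \in <<1; y'>>%VS by rewrite rpredZ ?rpred1.
  by apply: rpredM; apply: rpredX; rewrite ?(pres_pow pres); apply: Ain.
have yin : y \in <<1; y'>>%VS.
  by rewrite -(mulfK c0 y) -yE rpredM ?rpredV // rpredX // memv_adjoin.
apply/eqP; rewrite eqEsubv subvf -(pres_gen pres) /=.
by apply/FadjoinP; rewrite yin subv_adjoin.
Qed.

(** Up to a power of [X] the polynomial is a polynomial in [1/X] with non-zero
    constant term, a unit wherever [1/X] vanishes. *)
Lemma val_infinite (P : place L) c : 0 < P (X^-1)%:A -> c != 0 ->
  P (atL X y c%:P) = - (P (X^-1)%:A * (size c).-1%:Z).
Proof.
move=> Pw c0; set w : L := (X^-1)%:A in Pw *.
have Xi0 : X^-1 != 0 by rewrite invr_eq0; exact: X0.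
have w0 : w != 0 by rewrite scaler_eq0 oner_eq0 orbF.
have -> : atL X y c%:P = w ^- (size c).-1 * atL X^-1 y (reciprocal c)%:P.
  rewrite !atLC (atK_reciprocal X0 c0) -!in_algE rmorphM rmorphXn.
  by rewrite -exprVn /w -in_algE -fmorphV invrK.
have rec0 : atL X^-1 y (reciprocal c)%:P != 0.
  rewrite atLC scaler_eq0 oner_eq0 orbF; apply: contraNneq (atK_neq0 pres c0) => e.
  by rewrite (atK_reciprocal X0 c0) e mulr0.
rewrite valM ?invr_eq0 ?expf_neq0 // valV ?expf_neq0 // valX // pmulrn mulrzz.
rewrite (@val_coprime _ _ X^-1 y P _ 'X) ?addr0 ?dvdX_reciprocal //.
- by rewrite vgeE // ltW.
- exact: irreducible_X.
- by rewrite atLC atKX.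
Qed.

End Inverse.
End Infinity.

(** * A divisor class of order p *)

Lemma squarefree_irreducible (F : fieldType) (B Q : {poly F}) :
    squarefree_poly B -> irreducible_poly Q -> Q %| B ->
  exists C1, B = Q * C1 /\ ~~ (Q %| C1).
Proof.
move=> [_ Bsq] irrQ /dvdpP[C1 BE]; exists C1; split; first by rewrite mulrC.
apply/negP => QC1; have := irrQ.1; rewrite (Bsq Q) //.
by rewrite BE expr2 dvdp_mul.
Qed.

Lemma two_irreducible_factors (F : fieldType) (B : {poly F}) r :
    factors_into B r -> (2 <= r)%N ->
  exists Q1 Q2, [/\ irreducible_poly Q1, irreducible_poly Q2,
    Q1 %| B, Q2 %| B & ~~ (Q2 %| Q1)].
Proof.
move=> [s [us sP ->]] r2; have size_s : size s = r by rewrite size_tuple.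
have s0 : s`_0 \in s by rewrite mem_nth // size_s ltnW.
have s1 : s`_1 \in s by rewrite mem_nth // size_s.
have [[mon0 irr0] [mon1 irr1]] := (sP _ s0, sP _ s1).
have dvd Q : Q \in s -> Q %| lead_coef B *: \prod_(P <- s) P.
  move=> Qs; rewrite -mul_polyC dvdp_mull //.
  by rewrite (big_rem Q) //= dvdp_mulr.
exists s`_0, s`_1; split=> //; try exact: dvd.
apply/negP => /(irr0 _ _); have := irr1.1; case: (size _) => [|[|n]] // _.
move=> /(_ isT); rewrite (eqp_monic mon1 mon0) => /eqP e.
have := nth_uniq 0 (i := 1) (j := 0) _ _ us; rewrite size_s e eqxx.
by move=> /(_ r2 (ltnW r2)).
Qed.

Section TorsionClass.
Variables (Fq : finFieldType) (L : fieldExtType {fraction {poly Fq}}).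
Variables (x : {fraction {poly Fq}}) (y yi : L) (p : nat) (B : {poly Fq}).
Variables (Q1 : {poly Fq}) (P1 Pinf : place L).
Hypotheses (p_prime : prime p) (pres : presentation x y p B).
Hypotheses (irrQ1 : irreducible_poly Q1) (B0 : B != 0).
Hypotheses (ram1 : ramified_place x y p Q1 P1).
Hypotheses (ram_inf : ramified_place x^-1 yi p 'X Pinf).
Local Notation atL := (atL x y).
Local Notation m := (size Q1).-1.

Let x0 : x != 0.
Proof. by rewrite -(atKX x) (atK_neq0 pres) // polyX_eq0. Qed.

Let xL0 : x%:A != 0 :> L.
Proof. by rewrite scaler_eq0 oner_eq0 orbF. Qed.

Let xVE : (x^-1)%:A = x%:A^-1 :> L.
Proof. by rewrite -!in_algE fmorphV. Qed.

Let Pinf_xV : Pinf (x^-1)%:A = p.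
Proof. by rewrite -(ram_Q ram_inf) atLC atKX. Qed.

Let p_gt0 : 0 < p%:Z.
Proof. by rewrite ltz_nat prime_gt0. Qed.

Lemma val_inf c : c != 0 -> Pinf (atL c%:P) = - (p%:Z * (size c).-1%:Z).
Proof. by move=> c0; rewrite (val_infinite pres) // Pinf_xV. Qed.

Lemma Pinf_x : ~~ vge Pinf 0 x%:A.
Proof.
rewrite vgeE //; have := Pinf_xV; rewrite xVE valV // => e.
by rewrite -oppr_le0 e -ltNge.
Qed.

Lemma P1_x : vge P1 0 x%:A.
Proof. by have := ram_int ram1 ('X%:P); rewrite atLC atKX. Qed.

Lemma P1_neq_Pinf : P1 != Pinf.
Proof. by apply: contraNneq Pinf_x => <-; exact: P1_x. Qed.

(** A zero of [Q1] is [P1] and a pole is [Pinf], by the uniqueness of the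
    ramified places. *)
Lemma val_Q1 (P : place L) : P (atL Q1%:P) =
  ((P1 == P)%:R - (Pinf == P)%:R *+ m) *+ p.
Proof.
have Q10 := irredp_neq0 irrQ1.
have [<-|nP1] := eqVneq P1 P.
  rewrite eq_sym (negPf P1_neq_Pinf) mul0rn subr0 (ram_Q ram1).
  by rewrite pmulrn mulrzz mul1r.
have [<-|nPinf] := eqVneq Pinf P.
  by rewrite val_inf // sub0r mulNrn -mulrnA pmulrn mulrzz mul1r PoszM mulrC.
rewrite mul0rn subrr mul0rn.
have [Px|] := boolP (vge P 0 x%:A).
  have := vge_atLC y Px Q1; rewrite vgeE ?(atLC_neq0 pres) // le_eqVlt.
  case/orP => [/eqP->//|PQ1]; case/eqP: nP1.
  by rewrite (ram_unique ram1 Px PQ1).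
rewrite vgeE // -ltNge => Px; case/eqP: nPinf; apply/esym.
have PxV : 0 < P (x^-1)%:A by rewrite xVE valV // oppr_gt0.
apply: (ram_unique ram_inf); last by rewrite atLC atKX.
by apply/valuation_ringE; right; apply: ltW.
Qed.

Definition torsion_divisor : {freeg (place L)} := << P1 >> - << Pinf >> *+ m.

Lemma torsion_divisor_degree0 : torsion_divisor \in @degree0 Fq L.
Proof.
rewrite unfold_in /degree0 raddfB raddfMn /= /divisor_degree !liftU.
rewrite !scale1r (ram_degree ram1) (ram_degree ram_inf) size_polyX /=.
by rewrite pmulrn mulrzz mul1r subrr.
Qed.

Definition torsion_divisor0 := Divisor0 torsion_divisor_degree0.

Lemma coeff_torsion P :
  coeff P torsion_divisor = (P1 == P)%:R - (Pinf == P)%:R *+ m.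
Proof. by rewrite coeffB coeffMn !coeffU !mul1r. Qed.

Lemma torsion_principal : torsion_divisor0 *+ p \in @principal Fq L.
Proof.
rewrite unfold_in; apply/asboolP; exists (atL Q1%:P).
  by rewrite (atLC_neq0 pres) // irredp_neq0.
by move=> P; rewrite raddfMn /= coeffMn coeff_torsion val_Q1.
Qed.

(** A function with this divisor would be [\sum_i a_i * y ^+ i] with polynomial
    coefficients. Its zero at [P1] makes [Q1] divide [a_0], its not
    vanishing at [P2] makes [a_0] non-zero, so [a_0] has degree at least [m];
    its pole at infinity then has order at least [p * m], but this order is
    [m]. *)
Lemma torsion_nonprincipal Q2 P2 :
    p%:R != 0 :> Fq -> squarefree_poly B -> ~~ (p %| (size B).-1)%N ->
    irreducible_poly Q2 -> ~~ (Q2 %| Q1) -> ramified_place x y p Q2 P2 ->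
  torsion_divisor0 \notin @principal Fq L.
Proof.
move=> p_neq0 Bsq pB irrQ2 nQ21 ram2.
apply/negP; rewrite unfold_in => /asboolP[z z0 /= zE].
have {}zE (P : place L) : P z = (P1 == P)%:R - (Pinf == P)%:R *+ m.
  by rewrite -zE coeff_torsion.
have [a [sa za]] : exists a : {poly {poly Fq}}, (size a <= p)%N /\ z = atL a.
  apply: (regular_integral pres p_prime _ p_neq0).
    by move=> Q irrQ QB; apply: squarefree_irreducible.
  move=> P Px; rewrite vgeE // zE.
  have -> : (Pinf == P) = false.
    by apply: contraNF Pinf_x => /eqP->.
  by rewrite mul0rn subr0 ler0n.
have P2z : P2 z = 0.
  have nP1 : P1 != P2.
    apply: contraTneq p_gt0 => eP.
    by rewrite -(ram_Q ram1) eP (ram_unit ram2).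
  have nPinf : Pinf != P2.
    apply: contraNneq Pinf_x => ->.
    by have := ram_int ram2 ('X%:P); rewrite atLC atKX.
  by rewrite zE (negPf nP1) (negPf nPinf) mul0rn subr0.
have a0 : a`_0 != 0.
  have [a' aE] := poly_divX a; apply/eqP => a0.
  have zy : z = y * atL a' by rewrite za aE a0 polyC0 addr0 atLM atLX mulrC.
  have y1 : vge P2 1 y by apply/maximal_idealE; right; rewrite /= (ram_y ram2).
  have : vge P2 1 z by rewrite zy; apply: vgeMr => //; apply: (ram_int ram2).
  by rewrite vgeE // P2z.
have Qa0 : Q1 %| a`_0.
  apply: contraT => nQa.
  have := ramified_power_basis pres p_prime irrQ1 ram1 sa nQa.
  by rewrite -za zE eqxx eq_sym (negPf P1_neq_Pinf) mul0rn subr0.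
have yp : Pinf y = - (size B).-1%:Z.
  have y0 : y != 0.
    have := atLC_neq0 pres B0; rewrite -(atL_pow pres).
    by apply: contraNneq => ->; rewrite expr0n gtn_eqF // prime_gt0.
  have := val_inf B0; rewrite -(atL_pow pres) valX // pmulrn mulrzz mulrC -mulrN.
  by apply: mulfI; rewrite gt_eqF.
have pPy : ~~ (p %| Pinf y)%Z by rewrite yp dvdzE abszN.
have pPc c : c != 0 -> (p %| Pinf (atL c%:P))%Z.
  by move=> c0; rewrite val_inf // -mulrN dvdz_mulr.
have := val_power_basis pres p_prime pPy pPc sa a0.
rewrite -za zE eqxx (negPf P1_neq_Pinf) val_inf // mulr0 addr0 sub0r.
have := dvdp_leq a0 Qa0; have := irrQ1.1; have := prime_gt1 p_prime.
rewrite lerN2 -PoszM natz lez_nat; move: (size Q1) (size a`_0) => u v p1 u1 uv.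
by clear -p1 u1 uv; nia.
Qed.

End TorsionClass.

Lemma dvdX_expr (F : fieldType) (c : {poly F}) n :
  ~~ ('X %| c) -> ~~ ('X %| c ^+ n).
Proof.
by rewrite -['X]subr0 !dvdp_XsubCl /root horner_exp; apply: expf_neq0.
Qed.

Theorem theorem4p1
  (Fq : finFieldType) (L : fieldExtType {fraction {poly Fq}}) (y : L)
  (p : nat) (p_prime : prime p)
  (B : {poly Fq}) (r : nat)
  (L_gen : <<1; y>>%VS = fullv) (L_deg : \dim {:L} = p)
  (y_eq : y ^+ p = (tofrac B)%:A)
  (B_sqfree : squarefree_poly B) (B_fact : factors_into B r)
  (p_degB : ~~ (p %| (size B).-1)%N) (p_char : p \notin [pchar Fq])
  (r_ge2 : (2 <= r)%N)
  (h : nat) (h_class : is_class_number L h) :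
  (p %| h)%N.
Proof.
have B0 := B_sqfree.1.
have p_neq0 : p%:R != 0 :> Fq by move: p_char; rewrite inE p_prime.
have pres := presentation_finite L_gen L_deg (prime_gt0 p_prime) y_eq.
have [Q1 [Q2 [irrQ1 irrQ2 Q1B Q2B nQ21]]] :=
  two_irreducible_factors B_fact r_ge2.
have [C1 [BE1 nQC1]] := squarefree_irreducible B_sqfree irrQ1 Q1B.
have [C2 [BE2 nQC2]] := squarefree_irreducible B_sqfree irrQ2 Q2B.
have [P1 ram1] := ramified_place_ex pres irrQ1 BE1 nQC1.
have [P2 ram2] := ramified_place_ex pres irrQ2 BE2 nQC2.
(* Bezout for the coprime integers p and deg B. *)
have [i [j ij]] : exists i j, (j * (size B).-1 + 1 = i * p)%N.
  move: p_degB; rewrite -prime_coprime // => /(coprimeP _ (prime_gt0 p_prime)).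
  by move=> [[i j] /= ij]; exists i, j; lia.
have pres_inf := presentation_inverse pres p_prime B0 ij.
have [Pinf ram_inf] := ramified_place_ex pres_inf (irreducible_X _) erefl
  (dvdX_expr j (dvdX_reciprocal B0)).
have [e e_bij] := class_number_bijective h_class.
pose D := torsion_divisor0 ram1 ram_inf.
pose g : class_group L := (\pi_(Quotient.quot (@principal Fq L)) D)%qT.
apply: (dvdn_card_translation (g := g) p_prime e_bij).
  rewrite -[0](raddf0 (\pi_(Quotient.quot (@principal Fq L)))%qT).
  rewrite -Quotient.idealrBE subr0.
  exact: (torsion_nonprincipal p_prime pres irrQ1 B0 ram1 ram_inf p_neq0 B_sqfree
    p_degB irrQ2 nQ21 ram2).
rewrite -raddfMn -[RHS](raddf0 (\pi_(Quotient.quot (@principal Fq L)))%qT).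
apply/eqP; rewrite -Quotient.idealrBE subr0.
exact: (torsion_principal p_prime pres irrQ1 ram1 ram_inf).
Qed.
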